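(* Let $M(\Sigma)$ be a binary signed-graphic matroid such that every non-graphic cocircuit of $M(\Sigma)$ is non-separating, and let $Y$ be a non-graphic cocircuit of $M(\Sigma)$. Then every non-graphic cocircuit $Y'$ of $M(\Sigma)\backslash Y$ is also non-separating.
   Context: Signed graph $\Sigma=(G,\sigma)$: finite graph with links, loops, half-edges, loose edges, signs in $\{\pm1\}$ (half-edges negative, loose edges positive); cycle sign = product of edge signs. $M(\Sigma)$: matroid on $E(\Sigma)$ with circuits the edge sets of positive cycles, of two vertex-disjoint negative cycles joined by a path meeting them only at its ends, and of two negative cycles with exactly one common vertex. For a binary matroid $N$, a cocircuit $Y$ is graphic if $N\backslash Y$ is a graphic matroid and non-graphic otherwise; $Y$ is separating if $N\backslash Y$ is disconnected (has more than one elementary separator) and non-separating otherwise. *)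

(* Defs.v *)
From mathcomp Require Import all_boot all_order all_algebra.
Set Implicit Arguments.
Unset Strict Implicit.
Unset Printing Implicit Defensive.
Import GRing.Theory.

(* The ground set is a subset of an ambient finite type, so that a matroid    *)
(* and its deletions share the same type.                                     *)
Record matroid (T : finType) := Matroid {
  ground : {set T};
  indep : {set {set T}};
  indep_ground : forall X : {set T}, X \in indep -> X \subset ground;
  indep0 : set0 \in indep;
  indepS : forall X Y : {set T}, X \subset Y -> Y \in indep -> X \in indep;
  indep_aug : forall X Y : {set T}, X \in indep -> Y \in indep -> #|X| < #|Y| ->
    exists2 y, y \in Y :\: X & y |: X \in indep
}.

Section Matroid.
Variables (T : finType) (M : matroid T).
Implicit Types (X Y B C : {set T}).

Definition base B : bool := maxset [pred X : {set T} | X \in indep M] B.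

Definition circuit C : bool :=
  minset [pred X : {set T} | (X \subset ground M) && (X \notin indep M)] C.

Section Delete.
Variable D : {set T}.

Definition delete_indep : {set {set T}} :=
  [set X in indep M | X \subset ground M :\: D].

Lemma delete_indep_ground X : X \in delete_indep -> X \subset ground M :\: D.
Proof. by rewrite inE => /andP[]. Qed.

Lemma delete_indep0 : set0 \in delete_indep.
Proof. by rewrite inE indep0 sub0set. Qed.

Lemma delete_indepS X Y : X \subset Y -> Y \in delete_indep -> X \in delete_indep.
Proof.
move=> sXY; rewrite !inE => /andP[iY sY].
by rewrite (indepS sXY iY) (subset_trans sXY sY).
Qed.

Lemma delete_indep_aug X Y :
  X \in delete_indep -> Y \in delete_indep -> #|X| < #|Y| ->
  exists2 y, y \in Y :\: X & y |: X \in delete_indep.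
Proof.
rewrite !inE => /andP[iX sX] /andP[iY sY] ltXY.
have [y yYX iyX] := indep_aug iX iY ltXY; exists y => //.
rewrite inE iyX subUset sX andbT sub1set.
by apply: (subsetP sY); case/setDP: yYX.
Qed.

Definition delete : matroid T :=
  Matroid delete_indep_ground delete_indep0 delete_indepS delete_indep_aug.

End Delete.

Lemma base_indep B : base B -> B \in indep M.
Proof. by case/maxsetP. Qed.

Lemma leq_card_base B X : base B -> X \in indep M -> #|X| <= #|B|.
Proof.
case/maxsetP=> /= iB maxB iX; rewrite leqNgt; apply/negP=> ltBX.
have [y /setDP[_ yB] iyB] := indep_aug iB iX ltBX.
by move/negP: yB; apply; rewrite -(maxB _ iyB (subsetU1 _ _)) setU11.
Qed.

Lemma indep_card_base B X :
  base B -> X \in indep M -> #|B| <= #|X| -> base X.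
Proof.
move=> bB iX leBX; apply/maxsetP; split=> // Y /= iY sXY.
by apply/esym/eqP; rewrite eqEcard sXY (leq_trans (leq_card_base bB iY)).
Qed.

Lemma base_extend B X : base B -> X \in indep M ->
  exists B', [/\ base B', X \subset B' & B' \subset X :|: B].
Proof.
move=> bB iX.
pose P Y := [&& Y \in indep M, X \subset Y & Y \subset X :|: B].
have PX : P X by rewrite /P iX subxx subsetUl.
have [J /maxsetP[/and3P[iJ sXJ sJ] maxJ] _] := maxset_exists PX.
exists J; split=> //; apply: (indep_card_base bB iJ).
rewrite leqNgt; apply/negP=> ltJB.
have [y /setDP[yB yJ] iyJ] := indep_aug iJ (base_indep bB) ltJB.
have PyJ : P (y |: J).
  rewrite /P iyJ (subset_trans sXJ (subsetU1 _ _)) subUset sJ sub1set inE yB.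
  by rewrite orbT.
by move/negP: yJ; apply; rewrite -(maxJ _ PyJ (subsetU1 _ _)) setU11.
Qed.

Definition dual_indep : {set {set T}} :=
  [set X : {set T} | [exists B, base B && (X \subset ground M :\: B)]].

Lemma dual_indep_ground X : X \in dual_indep -> X \subset ground M.
Proof.
rewrite inE => /existsP[B /andP[_ sX]].
exact: subset_trans sX (subsetDl _ _).
Qed.

Lemma dual_indep0 : set0 \in dual_indep.
Proof.
have [B bB _] := @maxset_exists _ [pred X : {set T} | X \in indep M] _ (indep0 M).
by rewrite inE; apply/existsP; exists B; rewrite /base bB sub0set.
Qed.

Lemma dual_indepS X Y : X \subset Y -> Y \in dual_indep -> X \in dual_indep.
Proof.
move=> sXY; rewrite !inE => /existsP[B /andP[bB sY]].
by apply/existsP; exists B; rewrite bB (subset_trans sXY sY).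
Qed.

Lemma dual_indep_aug X Y :
  X \in dual_indep -> Y \in dual_indep -> #|X| < #|Y| ->
  exists2 y, y \in Y :\: X & y |: X \in dual_indep.
Proof.
move=> dX dY ltXY; have gX := dual_indep_ground dX.
have gY := dual_indep_ground dY.
move: dX dY; rewrite !inE => /existsP[BX /andP[bBX sX]].
move=> /existsP[BY /andP[bBY sY]].
have XBX x : x \in X -> x \notin BX by move/(subsetP sX); case/setDP.
have YBY x : x \in Y -> x \notin BY by move/(subsetP sY); case/setDP.
have iBYX : BY :\: X \in indep M by apply: indepS (subsetDl _ _) (base_indep bBY).
have [B [bB sBYX sB]] := base_extend bBX iBYX.
have XB x : x \in X -> x \notin B.
  move=> xX; apply/negP=> /(subsetP sB); rewrite !inE xX /= => xBX.
  by move/negP: (XBX _ xX).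
have [/subsetP sYXB|/subsetPn[y yYX yB]] := boolP (Y :\: X \subset B); last first.
  exists y => //; rewrite inE; apply/existsP; exists B; rewrite bB /=.
  apply/subsetP=> z; rewrite !inE => /orP[/eqP->|zX].
    by rewrite yB (subsetP gY) //; case/setDP: yYX.
  by rewrite XB //= (subsetP gX).
move: ltXY; rewrite ltnNge => /negP[].
have sU : (BY :\: X) :|: (Y :\: X) \subset B.
  by rewrite subUset sBYX; apply/subsetP.
have dU : (BY :\: X) :&: (Y :\: X) = set0.
  apply/setP=> z; rewrite !inE; apply/negP=> /andP[/andP[_ zBY] /andP[_ zY]].
  by move/negP: (YBY _ zY).
have := leq_trans (subset_leq_card sU) (leq_card_base bBY (base_indep bB)).
rewrite cardsU dU cards0 subn0 -(cardsID X BY) addnC leq_add2r => leYX.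
rewrite -(cardsID X Y) -(cardsID Y X) (setIC X Y) leq_add2l.
apply: (leq_trans leYX); apply: subset_leq_card; apply/subsetP=> z.
rewrite !inE => /andP[zBY zX]; rewrite zX andbT.
by apply/negP=> /YBY/negP.
Qed.

Definition dual : matroid T :=
  Matroid dual_indep_ground dual_indep0 dual_indepS dual_indep_aug.

Definition separator (S : {set T}) : bool :=
  (S \subset ground M) &&
  [forall C, circuit C ==> ((C \subset S) || (C \subset ground M :\: S))].

Definition elementary_separator (S : {set T}) : bool :=
  minset [pred X : {set T} | (X != set0) && separator X] S.

Definition disconnected : bool :=
  1 < #|[set S : {set T} | elementary_separator S]|.

(* [free] is taken on the family indexed by X, so it fails when two elements  *)
(* of X are sent to the same vector.                                          *)
Definition binary : Prop :=
  exists (n : nat) (f : T -> 'rV['F_2]_n),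
    forall X, X \subset ground M -> (X \in indep M) = free [seq f x | x in X].

End Matroid.

Definition cocircuit (T : finType) (M : matroid T) (Y : {set T}) : bool :=
  circuit (dual M) Y.

(* [Ends u v] is a link if u != v and a loop if u = v; the order of the two   *)
(* ends is irrelevant.                                                        *)
Inductive incidence (V : Type) :=
  | Ends of V & V
  | Half of V
  | Loose.
Arguments Loose {V}.

Definition graph (V E : Type) := E -> incidence V.

Section Graph.
Variables (V E : finType) (G : graph V E).

Definition incident (v : V) (e : E) : bool :=
  match G e with
  | Ends a b => (v == a) || (v == b)
  | Half a => v == a
  | Loose => false
  end.

Definition vertices (X : {set E}) : {set V} :=
  [set v | [exists e in X, incident v e]].

Definition joins (e : E) (u v : V) : bool :=
  if G e is Ends a b then
    ((a == u) && (b == v)) || ((a == v) && (b == u))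
  else false.

(* A walk from u is the list of its successive steps (edge, next vertex).     *)
Fixpoint walk (u : V) (p : seq (E * V)) : bool :=
  if p is (e, v) :: p' then joins e u v && walk v p' else true.

Definition walk_end (u : V) (p : seq (E * V)) : V := last u (unzip2 p).

(* The distinctness of the edges only matters for walks of length two, which  *)
(* must not traverse the same link back and forth. A half-edge, or a loose    *)
(* edge, is by itself a cycle.                                                *)
Definition is_cycle (C : {set E}) : Prop :=
  [\/ exists v p, [/\ (0 < size p) && walk v p, walk_end v p = v,
        uniq (unzip2 p), uniq (unzip1 p) & C = [set:: unzip1 p]],
      exists e v, G e = Half v /\ C = [set e]
    | exists e, G e = Loose /\ C = [set e]].

End Graph.

(* The graph realising M has the elements of M as edges (an isomorphism of M  *)
(* with a cycle matroid amounts to relabelling the edges), and all of them    *)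
(* are links or loops. The values of G outside ground M are irrelevant.       *)
Definition graphic (T : finType) (M : matroid T) : Prop :=
  exists (V : finType) (G : graph V T),
    (forall e, e \in ground M -> exists u v, G e = Ends u v) /\
    (forall C : {set T}, circuit M C <-> C \subset ground M /\ is_cycle G C).

Record signed_graph (V E : finType) := SignedGraph {
  sgraph : graph V E;
  negative_edge : pred E;
  half_negative : forall e v, sgraph e = Half v -> negative_edge e;
  loose_positive : forall e, sgraph e = Loose -> ~~ negative_edge e
}.

Section SignedGraph.
Variables (V E : finType) (S : signed_graph V E).

Definition edge_sign (e : E) : int := ((-1) ^+ negative_edge S e)%R.

Definition set_sign (C : {set E}) : int := (\prod_(e in C) edge_sign e)%R.

Definition positive_cycle (C : {set E}) : Prop :=
  is_cycle (sgraph S) C /\ set_sign C = 1%R.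

Definition negative_cycle (C : {set E}) : Prop :=
  is_cycle (sgraph S) C /\ set_sign C = (-1)%R.

Definition loose_handcuff (C : {set E}) : Prop :=
  exists (C1 C2 : {set E}) (u v : V) (p : seq (E * V)),
    let W : {set V} := [set:: u :: unzip2 p] in
    [/\ negative_cycle C1 /\ negative_cycle C2,
        vertices (sgraph S) C1 :&: vertices (sgraph S) C2 = set0,
        [/\ walk (sgraph S) u p, walk_end u p = v & uniq (u :: unzip2 p)],
        W :&: vertices (sgraph S) C1 = [set u] /\
        W :&: vertices (sgraph S) C2 = [set v]
      & C = C1 :|: [set:: unzip1 p] :|: C2].

(* C1 <> C2 is not implied by the condition on the vertices: C1 = C2 could be *)
(* a single half-edge or negative loop.                                       *)
Definition tight_handcuff (C : {set E}) : Prop :=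
  exists C1 C2 : {set E},
    [/\ negative_cycle C1 /\ negative_cycle C2, C1 <> C2,
        #|vertices (sgraph S) C1 :&: vertices (sgraph S) C2| = 1
      & C = C1 :|: C2].

Definition signed_circuit (C : {set E}) : Prop :=
  [\/ positive_cycle C, loose_handcuff C | tight_handcuff C].

(* M is M(S); a matroid is determined by its ground set and circuits, see     *)
(* signed_graphic_matroid_unique.                                             *)
Definition is_signed_graphic_matroid (M : matroid E) : Prop :=
  ground M = [set: E] /\ forall C : {set E}, circuit M C <-> signed_circuit C.

End SignedGraph.

Lemma indep_circuitP (T : finType) (M : matroid T) (X : {set T}) :
  X \subset ground M ->
  reflect (exists2 C, circuit M C & C \subset X) (X \notin indep M).
Proof.
move=> gX; apply: (iffP idP) => [nX|[C /minsetP[/andP[_ nC] _] sCX]].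
  have PX : [pred X : {set T} | (X \subset ground M) && (X \notin indep M)] X.
    by rewrite /= gX.
  by have [C cC sCX] := minset_exists PX; exists C.
by apply: contra nC; apply: indepS.
Qed.

Lemma signed_graphic_matroid_unique (V E : finType) (S : signed_graph V E)
    (M N : matroid E) :
  is_signed_graphic_matroid S M -> is_signed_graphic_matroid S N ->
  indep M = indep N.
Proof.
move=> [gM cM] [gN cN]; apply/setP=> X; apply: negb_inj.
have sM : X \subset ground M by rewrite gM subsetT.
have sN : X \subset ground N by rewrite gN subsetT.
by apply/(indep_circuitP sM)/(indep_circuitP sN) => -[C cC sC];
  exists C => //; [apply/cN/cM | apply/cM/cN].
Qed.

Section CocircuitKinds.
Variables (T : finType) (N : matroid T) (Y : {set T}).

Definition nongraphic_cocircuit : Prop :=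
  cocircuit N Y /\ ~ graphic (delete N Y).

Definition separating : bool := disconnected (delete N Y).

Definition nonseparating : bool := ~~ separating.

End CocircuitKinds.

(* Main.v *)
(** Vectors over F_3 with at most two nonzero entries represent M(Sigma), and cocircuits are the
    minimal supports of linear functionals, that is, of functions on the vertices. Suppose that
    M \ Y \ Y' is a direct sum of two nonempty parts and let X be a minimal non-graphic subset; it
    lies in one of them. Its span contains every vertex vector of the vertex set K of X, for
    otherwise X is balanced, hence graphic.

    The part of Sigma off K is balanced. Otherwise there is a set Q of edges whose span meets that
    of K in the line of a single vertex r. Take a depth-first search tree of X rooted at r: the
    other edges join a vertex a to an ancestor, and their fundamental circuits are tree paths when
    the tree cycle is positive, and the tree path from a to r together with Q when it is negative.
    As M is binary, these circuits determine M restricted to X, which is therefore the cycle matroid of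
    the graph obtained by moving the upper end of every negative edge to one new vertex.

    The hypothesis on M, applied to the cut around a component of the part off K, then shows that
    no two vertices off K are adjacent. Hence an edge of M \ Y \ Y' in the part not containing X
    joins K to a vertex w all of whose neighbours lie in K, which makes the star of w a separator
    of M \ Y, although Y is a non-graphic cocircuit of M. *)
Require Import Defs.
From mathcomp Require Import all_boot all_order all_algebra.
From Stdlib Require Import Classical.
Set Implicit Arguments.
Unset Strict Implicit.
Unset Printing Implicit Defensive.
Import GRing.Theory.
Local Open Scope ring_scope.

(** * Linear dependence *)

(** Two fields divide the work. Over F_3 twice a vertex vector is nonzero, so negative cycles
    produce vertex vectors, and nonzero scalars are signs, so rescaling is switching. Over F_2 a
    vector is the plain sum of the rest of its fundamental circuit; the F_2 representation enters
    only to turn circuits read off over F_3 into a graph. The obstacle is that the hypothesis speaks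
    of cocircuits of M, while the two parts to be excluded appear only after two deletions. It is
    therefore applied to cocircuits of M built for the purpose. Their non-graphicness comes from X:
    a restriction that contains a non-graphic one is non-graphic. The set Q exists because M is
    connected, which is derived: a proper summand of M inside Y would be Y itself, then Y' would be
    a cocircuit of M, and deleting Y' would leave that summand apart. Connectedness is used in
    linear form throughout, as the impossibility of a direct sum decomposition of the span. *)

Section LinearDependence.
Variables (F : fieldType) (T I : finType) (v : T -> I -> F).
Implicit Types (X A B : {set T}) (c : T -> F) (phi w : I -> F).

Definition supported X c := forall e, e \notin X -> c e = 0.

Definition comb c (x : I) : F := \sum_e c e * v e x.

Definition dep X := exists c, [/\ supported X c, exists e, c e != 0 & forall x, comb c x = 0].

Definition inspan X w := exists c, supported X c /\ forall x, comb c x = w x.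

Definition pairing phi e : F := \sum_x phi x * v e x.

(** For disjoint A and B this says that their spans meet only in 0. It is the linear form of a
    separator, see [direct_separator] and [separator_direct]. *)
Definition direct A B := forall c, supported (A :|: B) c ->
  (forall x, comb c x = 0) -> forall x, \sum_(e in A) c e * v e x = 0.

Lemma comb_pairing phi c :
  \sum_x phi x * comb c x = \sum_e c e * pairing phi e.
Proof.
under eq_bigr do rewrite /comb mulr_sumr.
rewrite exchange_big /=; apply: eq_bigr => e _; rewrite mulr_sumr.
by apply: eq_bigr => x _; rewrite mulrCA.
Qed.

Lemma pairingB phi psi k e :
  pairing (fun x => phi x - k * psi x) e = pairing phi e - k * pairing psi e.
Proof.
rewrite /pairing mulr_sumr -sumrB; apply: eq_bigr => x _.
by rewrite mulrBl mulrA.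
Qed.

Lemma combB c c' k x : comb (fun e => c e - k * c' e) x = comb c x - k * comb c' x.
Proof.
rewrite /comb mulr_sumr -sumrB; apply: eq_bigr => e _.
by rewrite mulrBl mulrA.
Qed.

Lemma combD c c' k x : comb (fun e => c e + k * c' e) x = comb c x + k * comb c' x.
Proof.
rewrite /comb mulr_sumr -big_split; apply: eq_bigr => e _.
by rewrite mulrDl mulrA.
Qed.

Lemma combZ c k x : comb (fun e => k * c e) x = k * comb c x.
Proof. by rewrite /comb mulr_sumr; apply: eq_bigr => e _; rewrite mulrA. Qed.

Lemma comb_delta e k x : comb (fun e' => if e' == e then k else 0) x = k * v e x.
Proof.
rewrite /comb (bigD1 e) //= eqxx big1 ?addr0 // => e' /negPf ->.
by rewrite mul0r.
Qed.

Lemma comb_in X c x : supported X c -> comb c x = \sum_(e in X) c e * v e x.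
Proof.
move=> sc; rewrite /comb [RHS]big_mkcond; apply: eq_bigr => e _.
by case: ifPn => // /sc ->; rewrite mul0r.
Qed.

Lemma comb_restrict X c x :
  comb (fun e => if e \in X then c e else 0) x = \sum_(e in X) c e * v e x.
Proof.
rewrite /comb [RHS]big_mkcond; apply: eq_bigr => e _.
by case: ifP; rewrite ?mul0r.
Qed.

Lemma inspan_pairing X w phi : inspan X w ->
  (forall e, e \in X -> pairing phi e = 0) -> \sum_x phi x * w x = 0.
Proof.
move=> [c [sc cw]] h; under eq_bigr do rewrite -cw.
rewrite comb_pairing big1 // => e _.
by case: (boolP (e \in X)) => [/h -> | /sc ->]; rewrite ?mulr0 ?mul0r.
Qed.

(** A vector outside a subspace is separated from it by a functional. Here the functional is a
    column of the cokernel of the matrix whose rows are the vectors of X, with zero rows for the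
    other elements. *)
Lemma not_inspan X w : ~ inspan X w ->
  exists phi, (forall e, e \in X -> pairing phi e = 0) /\ \sum_x phi x * w x != 0.
Proof.
move=> nsp.
pose A := \matrix_(i < #|T|, j < #|I|)
  (if enum_val i \in X then v (enum_val i) (enum_val j) else 0).
pose r := \row_(j < #|I|) w (enum_val j).
have pairE (g h : I -> F) : \sum_(j < #|I|) g (enum_val j) * h (enum_val j) = \sum_x g x * h x.
  by rewrite [RHS](reindex_onto enum_val enum_rank) => [|x _];
    [apply: eq_bigl => j; rewrite enum_valK eqxx | rewrite enum_rankK].
have [rA|] := boolP (r <= A)%MS.
  case: nsp; case/submxP: rA => D rDA.
  exists (fun e => if e \in X then D 0 (enum_rank e) else 0).
  split=> [e /negPf -> // | x].
  have := congr1 (fun m : 'rV_(_) => m 0 (enum_rank x)) rDA.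
  rewrite !mxE enum_rankK => ->.
  rewrite /comb (reindex_onto enum_val enum_rank) => [|e _]; last by rewrite enum_rankK.
  apply: eq_big => [j | j _]; first by rewrite enum_valK eqxx.
  by rewrite !mxE enum_valK enum_rankK; case: ifP; rewrite ?mulr0 ?mul0r.
rewrite submxE => /rowV0Pn[] u; move=> /submxP[D ->].
move=> ne; have {ne} : r *m cokermx A != 0.
  by apply: contraNneq ne => ->; rewrite mulmx0.
case/matrix0Pn => i [j nz]; exists (fun x => cokermx A (enum_rank x) j).
split=> [e eX | ].
  have := congr1 (fun m : 'M_(_, _) => m (enum_rank e) j) (mulmx_coker A).
  rewrite !mxE => E; rewrite /pairing -(pairE (fun x => cokermx A (enum_rank x) j)) -[RHS]E.
  by apply: eq_bigr => l _; rewrite !mxE enum_rankK eX enum_valK mulrC.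
rewrite ord1 mxE in nz; rewrite -(pairE (fun x => cokermx A (enum_rank x) j)).
apply: contra_neq nz => nz; rewrite -[RHS]nz; apply: eq_bigr => l _.
by rewrite !mxE enum_valK mulrC.
Qed.

Lemma dep_mono X X' : X \subset X' -> dep X -> dep X'.
Proof.
move=> sXX' [c [sc nz z]]; exists c; split=> // e eX.
by apply: sc; apply: contra eX; apply: subsetP.
Qed.

Lemma dep_inspan X e : ~ dep X -> dep (e |: X) -> inspan X (v e).
Proof.
move=> nd [c [sc [e' nz] z]].
have [ce|ce] := eqVneq (c e) 0.
  case: nd; exists c; split=> //; last by exists e'.
  move=> t tX; have [->//|te] := eqVneq t e.
  by apply: sc; rewrite !inE negb_or te.
exists (fun t => if t == e then 0 else - (c e)^-1 * c t); split=> [t tX | x].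
  by case: eqVneq => // te; rewrite (sc t) ?mulr0 // !inE negb_or te.
have := z x; rewrite /comb (bigD1 e) //= => /(canRL (addKr _)) E.
rewrite (bigD1 e) //= eqxx mul0r add0r.
have -> : v e x = - (c e)^-1 * (- (c e * v e x) + 0).
  by rewrite addr0 mulrNN mulrA mulVf ?mul1r.
rewrite -E mulr_sumr; apply: eq_bigr => t /negPf ->.
by rewrite mulrA.
Qed.

Lemma inspan_mono X X' w : X \subset X' -> inspan X w -> inspan X' w.
Proof.
move=> sXX' [c [sc z]]; exists c; split=> // e eX.
by apply: sc; apply: contra eX; apply: subsetP.
Qed.

Lemma inspanD X w w' w'' k : inspan X w -> inspan X w' ->
  (forall x, w'' x = w x + k * w' x) -> inspan X w''.
Proof.
move=> [c [sc z]] [c' [sc' z']] E; exists (fun e => c e + k * c' e).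
split=> [e eX | x]; first by rewrite sc // sc' // mulr0 addr0.
by rewrite combD z z' E.
Qed.

Lemma inspanZ X w w' k : inspan X w -> (forall x, w' x = k * w x) -> inspan X w'.
Proof.
move=> [c [sc z]] E; exists (fun e => k * c e); split=> [e /sc ->|x]; first by rewrite mulr0.
by rewrite combZ z E.
Qed.

Lemma inspan_gen X e : e \in X -> inspan X (v e).
Proof.
move=> eX; exists (fun e' => if e' == e then 1 else 0); split=> [t tX | x].
  by case: eqP => // te; rewrite te eX in tX.
by rewrite comb_delta mul1r.
Qed.

Lemma comb_setU A B c x : [disjoint A & B] -> supported (A :|: B) c ->
  comb c x = \sum_(e in A) c e * v e x + \sum_(e in B) c e * v e x.
Proof.
move=> dAB sc; rewrite (comb_in _ sc) -bigU //=.
by apply: eq_bigl => e; rewrite !inE.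
Qed.

Lemma direct_sym A B : [disjoint A & B] -> direct A B -> direct B A.
Proof.
move=> dAB dir c sc z x; rewrite setUC in sc.
have := z x; rewrite (comb_setU _ dAB sc).
by rewrite (dir c sc z) add0r.
Qed.

Lemma direct_sub A B A' B' : [disjoint A & B] -> A' \subset A -> B' \subset B ->
  direct A B -> direct A' B'.
Proof.
move=> dAB sA sB dir c sc z x.
have sc2 : supported (A :|: B) c.
  by move=> e eAB; apply: sc; apply: contra eAB; apply: subsetP; apply: setUSS.
rewrite -[RHS](dir c sc2 z x) [RHS](bigID (mem A')) /=.
rewrite [X in _ = _ + X]big1 ?addr0 => [|e /andP[eA eA']]; last first.
  rewrite sc ?mul0r // inE negb_or eA' /=; apply: contraL eA => /(subsetP sB) eB.
  by rewrite (disjointFl dAB).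
by apply: eq_bigl => e; apply/idP/andP => [eA|[]//]; rewrite (subsetP sA).
Qed.

Lemma direct_inspan A B w : [disjoint A & B] -> direct A B ->
  inspan A w -> inspan B w -> forall x, w x = 0.
Proof.
move=> dAB dir [c [sc z]] [c' [sc' z']] x.
have s0 : supported (A :|: B) (fun e => c e - 1 * c' e).
  by move=> e; rewrite inE negb_or => /andP[/sc -> /sc' ->]; rewrite mulr0 subr0.
have s1 y : comb (fun e => c e - 1 * c' e) y = 0 by rewrite combB z z' mul1r subrr.
rewrite -z (comb_in _ sc) -[RHS](dir _ s0 s1 x); apply: eq_bigr => e eA.
by rewrite sc' ?mulr0 ?subr0 // (disjointFr dAB).
Qed.

Lemma direct_support (W : {set I}) A B :
  (forall e x, e \in A -> x \notin W -> v e x = 0) ->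
  (forall e x, e \in B -> x \in W -> v e x = 0) ->
  [disjoint A & B] -> direct A B.
Proof.
move=> hA hB dAB c sc z x.
case: (boolP (x \in W)) => xW; last by rewrite big1 // => e eA; rewrite hA ?mulr0.
have := z x; rewrite (comb_setU _ dAB sc) [X in _ + X]big1 ?addr0 // => e eB.
by rewrite hB ?mulr0.
Qed.

End LinearDependence.

(** * Matroids represented by vectors *)

Section Represented.
Variables (F : fieldType) (T I : finType).
Implicit Types (X Y A B C : {set T}) (v : T -> I -> F) (M N : matroid T).

Definition represents v M := forall X, X \subset ground M -> X \notin indep M <-> dep v X.

(** Connectedness of the restriction to X, stated for any set of elements so that no deletion has to
    be formed. *)
Definition undecomposable v X := forall A B, A :|: B = X -> [disjoint A & B] ->
  direct v A B -> A = set0 \/ B = set0.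

Lemma represents_delete v M Y : represents v M -> represents v (delete M Y).
Proof.
move=> rM X sX; rewrite -(rM X (subset_trans sX (subsetDl _ _))).
by rewrite !inE sX andbT.
Qed.

Lemma represents_indep v M X : represents v M -> X \subset ground M ->
  X \in indep M <-> ~ dep v X.
Proof.
move=> rM sX; rewrite -(rM X sX); split=> [->//|].
by case: (X \in indep M) => // H; case: H.
Qed.

Lemma base_inspan v M B e : represents v M -> base M B -> e \in ground M -> inspan v B (v e).
Proof.
move=> rM bB eM; have iB := base_indep bB; have sB := indep_ground iB.
have [eB|eB] := boolP (e \in B); first exact: inspan_gen.
apply: dep_inspan; first by apply/(represents_indep rM).
apply/(rM _); first by rewrite subUset sub1set eM sB.
apply/negP=> i; case/maxsetP: bB => _ /(_ _ i (subsetU1 _ _)) E.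
by case/negP: eB; rewrite -E setU11.
Qed.

Lemma spanning_indep v M X : represents v M -> X \subset ground M ->
  exists J, [/\ J \in indep M, J \subset X & forall t, t \in X -> inspan v J (v t)].
Proof.
move=> rM sX.
have P0 : [pred Z : {set T} | (Z \in indep M) && (Z \subset X)] set0.
  by rewrite /= indep0 sub0set.
have [J /maxsetP[/= /andP[iJ sJ] maxJ] _] := maxset_exists P0.
exists J; split=> // t tX.
have [tJ|tJ] := boolP (t \in J); first exact: inspan_gen.
apply: dep_inspan; first by apply/(represents_indep rM) => //; apply: subset_trans sX.
apply/(rM _).
  by rewrite subUset sub1set (subsetP sX) //; apply: subset_trans sX.
apply/negP=> i; case/negP: tJ; rewrite -(maxJ (t |: J)) ?setU11 ?subsetU1 //.
by rewrite i subUset sub1set tX.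
Qed.

(** X is dependent in the dual when it meets every base, that is, when its complement does not span;
    a functional then vanishes on the complement but not on the whole ground set. *)
Lemma dual_dependentP v M X : represents v M -> X \subset ground M ->
  X \notin dual_indep M <->
  exists phi, (exists2 e, e \in ground M & pairing v phi e != 0) /\
    forall e, e \in ground M :\: X -> pairing v phi e = 0.
Proof.
move=> rM sX; split=> [nX|[phi [[e eM nz] z]]]; last first.
  rewrite inE; apply/existsP => -[B /andP[bB sXB]].
  have := inspan_pairing (base_inspan rM bB eM).
  move=> /(_ phi) E; case/eqP: nz; apply: E => t tB; apply: z.
  rewrite inE (subsetP (indep_ground (base_indep bB)) _ tB) andbT.
  by apply: contraL tB => /(subsetP sXB); case/setDP.
have [J [iJ sJ spJ]] := spanning_indep rM (subsetDl (ground M) X).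
have sJM := indep_ground iJ.
have [e eM nsp] : exists2 e, e \in ground M & ~ inspan v J (v e).
  apply: NNPP => no; case/negP: nX; rewrite inE; apply/existsP; exists J.
  apply/andP; split; last first.
    apply/subsetP=> t tX; rewrite inE (subsetP sX) // andbT.
    by apply: contraL tX => /(subsetP sJ); case/setDP.
  apply/maxsetP; split=> // Z /= iZ sJZ; apply/eqP; rewrite eqEsubset sJZ andbT.
  apply/subsetP=> t tZ; apply/negPn/negP=> tJ.
  have [|c [sc cz]] := NNPP (inspan v J (v t)).
    by move=> H; apply: no; exists t => //; apply: (subsetP (indep_ground iZ)).
  case/(represents_indep rM (indep_ground iZ)): iZ.
  exists (fun e => c e - 1 * (if e == t then 1 else 0)); split=> [e eZ||x].
  - rewrite sc ?sub0r; last by apply: contra eZ; apply: subsetP.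
    by case: eqP => [E|_]; [rewrite E tZ in eZ | rewrite mulr0 oppr0].
  - by exists t; rewrite eqxx sc // mulr1 sub0r oppr_eq0 oner_eq0.
  by rewrite combB comb_delta cz !mul1r subrr.
have [phi [z nz]] := not_inspan nsp.
exists phi; split; first by exists e.
by move=> t tX; apply: (inspan_pairing (phi := phi) (spJ t tX) z).
Qed.

(** The support of the functional from [dual_dependentP] is itself dependent in the dual and
    contained in Y, so minimality makes it equal to Y. *)
Lemma cocircuit_functional v M Y : represents v M -> cocircuit M Y ->
  [/\ Y \subset ground M, Y != set0 &
   exists phi, forall e, e \in ground M -> (pairing v phi e != 0) = (e \in Y)].
Proof.
move=> rM /minsetP[/= /andP[sY nY] minY]; split=> //.
  by apply: contraNneq nY => ->; apply: dual_indep0.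
have [phi [[e eM nz] z]] := (dual_dependentP rM sY).1 nY.
pose Z := [set e in ground M | pairing v phi e != 0].
have sZY : Z \subset Y.
  apply/subsetP=> t; rewrite inE => /andP[tM]; apply: contraNT => tY.
  by rewrite z // inE tY.
have sZ := subset_trans sZY sY.
have EZ : Z = Y.
  apply: minY => //=; rewrite sZ /=; apply/(dual_dependentP rM sZ).
  exists phi; split; first by exists e.
  move=> t; rewrite inE => /andP[+ tM]; rewrite inE tM /= negbK.
  by move/eqP.
by exists phi => t tM; rewrite -EZ inE tM.
Qed.

Lemma cocircuit_minimal v M Y phi : represents v M -> cocircuit M Y ->
  (forall e, e \in ground M :\: Y -> pairing v phi e = 0) ->
  (exists2 e, e \in ground M & pairing v phi e != 0) ->
  forall e, e \in Y -> pairing v phi e != 0.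
Proof.
move=> rM /minsetP[/= /andP[sY nY] minY] z [e eM nz] t tY.
pose Z := [set e in ground M | pairing v phi e != 0].
have sZY : Z \subset Y.
  apply/subsetP=> u; rewrite inE => /andP[uM]; apply: contraNT => uY.
  by rewrite z // inE uY.
have sZ := subset_trans sZY sY.
have EZ : Z = Y.
  apply: minY => //=; rewrite sZ /=; apply/(dual_dependentP rM sZ).
  exists phi; split; first by exists e.
  move=> u; rewrite inE => /andP[+ uM]; rewrite inE uM /= negbK.
  by move/eqP.
by move: tY; rewrite -EZ inE => /andP[].
Qed.

Lemma cocircuitI v M Y phi : represents v M -> Y \subset ground M -> Y != set0 ->
  (forall e, e \in ground M -> (pairing v phi e != 0) = (e \in Y)) ->
  (forall psi, (forall e, e \in ground M :\: Y -> pairing v psi e = 0) ->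
     (exists2 e, e \in ground M & pairing v psi e != 0) ->
     forall e, e \in Y -> pairing v psi e != 0) ->
  cocircuit M Y.
Proof.
move=> rM sY /set0Pn[e eY] supp minY.
have eM := subsetP sY _ eY.
apply/minsetP; split=> [/= | Z /= /andP[sZM nZ] sZY].
  rewrite sY /=; apply/(dual_dependentP rM sY); exists phi; split.
    by exists e => //; rewrite supp.
  by move=> t /setDP[tM tY]; apply/eqP; rewrite -[_ == _]negbK supp.
have [psi [ex z]] := (dual_dependentP rM sZM).1 nZ.
apply/eqP; rewrite eqEsubset sZY; apply/subsetP=> t tY.
have zY u : u \in ground M :\: Y -> pairing v psi u = 0.
  move=> /setDP[uM uY]; apply: z; rewrite inE uM andbT.
  by apply: contra uY; apply: subsetP.
have := minY psi zY ex t tY; apply: contraNT => tZ.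
by rewrite z // inE tZ (subsetP sY).
Qed.

(** The relation on a circuit has full support. If the circuit met both A and B, the A-part of this
    relation would be a relation on a proper nonempty subset. *)
Lemma direct_separator v M A B : represents v M -> A :|: B = ground M ->
  [disjoint A & B] -> direct v A B -> separator M A.
Proof.
move=> rM EM dAB dir; have sA : A \subset ground M by rewrite -EM subsetUl.
rewrite /separator sA /=; apply/forallP=> C; apply/implyP=> cC.
have [/= /andP[sC nC] minC] := minsetP cC.
have indepP (Z : {set T}) : Z \subset C -> Z != C -> ~ dep v Z.
  move=> sZC neq dZ; case/eqP: neq; apply: minC => //=.
  rewrite (subset_trans sZC sC); apply/(rM _) => //; exact: subset_trans sC.
have [c [sc [e nz] z]] := (rM _ sC).1 nC.
have full t : t \in C -> c t != 0.
  move=> tC; apply/negP=> /eqP ct; apply: (indepP (C :\ t)); first exact: subsetDl.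
    by apply/eqP=> E; have := setD11 t C; rewrite E tC.
  exists c; split=> //; last by exists e.
  by move=> u; rewrite !inE negb_and negbK => /orP[/eqP ->|/sc].
have sAB : supported (A :|: B) c.
  by move=> u; rewrite EM => uM; apply: sc; apply: contra uM; apply: subsetP.
have zA := dir c sAB z.
have [CA|] := eqVneq (C :&: A) C; first by apply/orP; left; rewrite -CA subsetIr.
move/(indepP _ (subsetIl _ _)) => ndCA.
apply/orP; right; apply/subsetP=> t tC; rewrite inE (subsetP sC) // andbT.
apply/negP=> tA; apply: ndCA.
exists (fun e => if e \in A then c e else 0); split.
- by move=> u; rewrite inE negb_and => /orP[/sc ->|/negPf ->]; rewrite ?if_same.
- by exists t; rewrite tA full.
by move=> x; rewrite comb_restrict.
Qed.

(** Take maximal independent sets J in A and L in the complement. A circuit inside their union would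
    lie in J or in L, so the union is independent; a relation, rewritten in J and L, then has zero
    J-part. *)
Lemma separator_direct v M A : represents v M -> separator M A ->
  direct v A (ground M :\: A).
Proof.
move=> rM /andP[sA /forallP sepA] c sc z x.
have [J [iJ sJ spJ]] := spanning_indep rM sA.
have [L [iL sL spL]] := spanning_indep rM (subsetDl (ground M) A).
have sJM := subset_trans sJ sA.
have sLM := subset_trans sL (subsetDl _ _).
have dAB : [disjoint A & ground M :\: A] by rewrite disjoints_subset setCD subsetUr.
have comb_sp (D Z : {set T}) : (forall t, t \in D -> inspan v Z (v t)) ->
    inspan v Z (fun x => \sum_(e in D) c e * v e x).
  move=> sp; pose P (w : I -> F) := inspan v Z w.
  have : forall s : seq T, {subset s <= D} ->
      inspan v Z (fun x => \sum_(e <- s) c e * v e x).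
    elim=> [_|t s IH st].
      exists (fun=> 0); split=> // y; rewrite big_nil /comb big1 // => e _.
      by rewrite mul0r.
    apply: (inspanD (IH _) (sp t _) (k := c t)).
    - by move=> u us; apply: st; rewrite inE us orbT.
    - by apply: st; rewrite mem_head.
    by move=> y; rewrite big_cons addrC.
  move=> /(_ (enum D)) [t|g [sg gz]]; first by rewrite mem_enum.
  by exists g; split=> // y; rewrite gz big_enum.
have [a [sa za]] := comb_sp A J spJ.
have [b [sb zb]] := comb_sp (ground M :\: A) L spL.
have nJL : ~ dep v (J :|: L).
  move=> dJL; have sJL : J :|: L \subset ground M by rewrite subUset sJM.
  have /(indep_circuitP sJL) [C cC sCJL] := (rM _ sJL).2 dJL.
  have /implyP/(_ cC)/orP[CA|CB] := sepA C.
    have sCJ : C \subset J.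
      apply/subsetP=> t tC; have := subsetP sCJL _ tC; rewrite inE => /orP[//|/(subsetP sL)].
      by rewrite inE (subsetP CA).
    case/minsetP: cC => /= /andP[_ /negP nC] _; apply: nC; exact: indepS sCJ iJ.
  have sCL : C \subset L.
    apply/subsetP=> t tC; have := subsetP sCJL _ tC; rewrite inE => /orP[/(subsetP sJ) tA|//].
    by have := subsetP CB _ tC; rewrite inE tA.
  case/minsetP: cC => /= /andP[_ /negP nC] _; apply: nC; exact: indepS sCL iL.
have dJL : [disjoint J & L].
  by apply: disjointWl sJ _; apply: disjointWr sL _.
rewrite -za /comb big1 // => t _; have [->|nz] := eqVneq (a t) 0; first by rewrite mul0r.
case: nJL; exists (fun e => a e + 1 * b e); split.
- by move=> u; rewrite inE negb_or => /andP[/sa -> /sb ->]; rewrite mulr0 addr0.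
- exists t; rewrite sb ?mulr0 ?addr0 //.
  apply/negP=> tL; case/eqP: nz; apply: sa.
  by rewrite (disjointFl dJL tL).
move=> y; rewrite combD za zb mul1r -(comb_setU v y dAB sc); exact: z.
Qed.

Lemma connected_undecomposable v M : represents v M -> ~~ disconnected M ->
  undecomposable v (ground M).
Proof.
move=> rM nd A B EM dAB dir; apply: NNPP => /not_or_and[/eqP nA /eqP nB].
case/negP: nd.
have sepA := direct_separator rM EM dAB dir.
have sepB : separator M B.
  apply: (direct_separator rM _ _ (direct_sym dAB dir)); first by rewrite setUC.
  by rewrite disjoint_sym.
have [A' mA' sA'] := @minset_exists _ [pred X : {set T} | (X != set0) && separator M X] A
  (introT andP (conj nA sepA)).
have [B' mB' sB'] := @minset_exists _ [pred X : {set T} | (X != set0) && separator M X] B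
  (introT andP (conj nB sepB)).
have neAB : A' != B'.
  apply: contraTneq (mA') => E; apply/negP=> /minsetP[/= /andP[/set0Pn[x xA'] _] _].
  have := subsetP sA' _ xA'; rewrite E in xA'; have := subsetP sB' _ xA'.
  by move=> xB xA; rewrite (disjointFr dAB xA) in xB.
rewrite /disconnected (cardsD1 A') (cardsD1 B') !inE eq_sym neAB /elementary_separator mA' mB'.
by [].
Qed.

Lemma disconnected_direct v M : represents v M -> disconnected M ->
  exists A B, [/\ A :|: B = ground M, [disjoint A & B], direct v A B & A != set0 /\ B != set0].
Proof.
move=> rM /card_gt1P[A [B [+ + neAB]]]; rewrite !inE => /minsetP[/= /andP[nA sA] minA].
move=> /minsetP[/= /andP[nB sB] minB].
have sAM : A \subset ground M by case/andP: sA.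
exists A, (ground M :\: A); split; last split=> //.
- by rewrite -[RHS](setID _ A) (setIidPr sAM).
- by rewrite disjoints_subset setCD subsetUr.
- exact: separator_direct.
(* If A were the whole ground set it would contain B, and minimality of A would make the two
   separators equal. *)
apply: contra_neq neAB => /eqP; rewrite setD_eq0 => sMA.
apply/esym/minA; first by rewrite /= nB.
by apply: subset_trans sMA; case/andP: sB.
Qed.

End Represented.

Lemma free_dep (F : fieldType) (T : finType) n (f : T -> 'rV[F]_n) (X : {set T}) :
  ~~ free [seq f x | x in X] <-> dep (fun e i => f e 0 i) X.
Proof.
split=> [nf|[c [sc [e nz] z]]].
  apply: NNPP => nd; case/negP: nf; apply/(freeP (X := image_tuple f X)) => k kz i.
  apply/eqP/negPn/negP=> ki; apply: nd.
  (* The coefficients are indexed by positions in [enum X]. Off X the index equals the length,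
     [insub] fails, and the coefficient is 0. *)
  pose c e := if insub (index e (enum X)) is Some j then k j else 0.
  have cE j : c (enum_val j) = k j.
    rewrite /c /enum_val index_uniq ?enum_uniq ?valK //.
    by rewrite -cardE.
  have sc : supported X c.
    by move=> e eX; rewrite /c insubF // cardE index_mem mem_enum (negPf eX).
  exists c; split=> //; first by exists (enum_val i); rewrite cE.
  move=> x; rewrite (comb_in _ x sc).
  rewrite (big_enum_val (fun e => c e * f e 0 x)) /=.
  have := congr1 (fun r : 'rV_n => r 0 x) kz; rewrite /= summxE mxE => E.
  rewrite -[RHS]E; apply: eq_bigr => j _; rewrite !mxE cE /= (nth_image 0).
  by [].
apply/negP => /(freeP (X := image_tuple f X)) fr.
have eX : e \in X by apply: contraR nz => /sc ->.
have /eqP[] := nz; rewrite -(enum_rankK_in eX eX).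
apply: (fr (fun i => c (enum_val i)) _ (enum_rank_in eX e)).
apply/rowP=> x; rewrite summxE mxE -[RHS](z x) (comb_in _ x sc).
rewrite (big_enum_val (fun e => c e * f e 0 x)) /=.
by apply: eq_bigr => j _; rewrite !mxE /= (nth_image 0).
Qed.

Lemma binary_represented (T : finType) (M : matroid T) : binary M ->
  exists n (f : T -> 'I_n -> 'F_2), represents f M.
Proof.
move=> [n [f hf]]; exists n, (fun e i => f e 0 i) => X sX.
by rewrite hf // free_dep.
Qed.

(** * Walks and cycles *)

Section Walks.
Variables (V E : finType) (G : graph V E).
Implicit Types (u v w x y z : V) (e f : E) (p q : seq (E * V)) (C D : {set E}).

Lemma joins_sym e x y : joins G e x y = joins G e y x.
Proof. by rewrite /joins; case: (G e) => // a b; rewrite orbC. Qed.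

Lemma joinsP e x y : reflect (G e = Ends x y \/ G e = Ends y x) (joins G e x y).
Proof.
rewrite /joins; case: (G e) => [a b|a|]; try by constructor; case.
apply: (iffP orP) => [[/andP[/eqP -> /eqP ->]|/andP[/eqP -> /eqP ->]]|[[-> ->]|[-> ->]]];
  rewrite ?eqxx; auto.
Qed.

Lemma joins_incident e x y z : joins G e x y -> incident G z e = (z == x) || (z == y).
Proof. by rewrite /incident; case/joinsP => -> //; rewrite orbC. Qed.

Lemma walk_cat u p q : walk G u (p ++ q) = walk G u p && walk G (walk_end u p) q.
Proof. by elim: p u => [//|[e v] p IH] u /=; rewrite IH andbA. Qed.

Lemma walk_end_cat u p q : walk_end u (p ++ q) = walk_end (walk_end u p) q.
Proof. by rewrite /walk_end /unzip2 map_cat last_cat. Qed.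

Lemma walk_end_rcons u p e v : walk_end u (rcons p (e, v)) = v.
Proof. by rewrite /walk_end /unzip2 map_rcons last_rcons. Qed.

Lemma walk_rcons u p e v :
  walk G u (rcons p (e, v)) = walk G u p && joins G e (walk_end u p) v.
Proof. by rewrite -cats1 walk_cat /= andbT. Qed.

Lemma walk_end_mem u p : walk_end u p \in u :: unzip2 p.
Proof. exact: mem_last. Qed.

Lemma walk_incident u p e z : walk G u p -> e \in unzip1 p -> incident G z e ->
  z \in u :: unzip2 p.
Proof.
elim: p u => [//|[f v] p IH] u /= /andP[j w]; rewrite inE => /orP[/eqP ->|ep iz].
  by rewrite (joins_incident _ j) !inE => /orP[] ->; rewrite ?orbT.
by rewrite inE IH ?orbT.
Qed.

Lemma path_uniq_edges u p : walk G u p -> uniq (u :: unzip2 p) -> uniq (unzip1 p).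
Proof.
elim: p u => [//|[f v] p IH] u /= /andP[j w] /andP[uN /andP[vN uq]].
rewrite (IH v w) ?andbT /= ?vN //; apply: contra uN => fp.
by apply: (walk_incident w fp); rewrite (joins_incident _ j) eqxx.
Qed.

Lemma walk_rev u p : walk G u p -> exists q, [/\ walk G (walk_end u p) q,
  walk_end (walk_end u p) q = u, unzip1 q = rev (unzip1 p) &
  unzip2 q = behead (rev (u :: unzip2 p))].
Proof.
elim: p u => [|[f v] p IH] u /=; first by exists [::].
move=> /andP[j /IH[q [wq eq q1 q2]]]; exists (rcons q (f, u)).
have -> : walk_end u ((f, v) :: p) = walk_end v p by [].
rewrite walk_end_rcons walk_rcons wq eq joins_sym j /unzip1 /unzip2 !map_rcons.
rewrite -/(unzip1 q) -/(unzip2 q) q1 q2; split=> //; first by rewrite rev_cons.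
rewrite [in RHS]rev_cons; case: (rev (v :: unzip2 p)) (size_rev (v :: unzip2 p)) => //.
Qed.

Definition closed_walk v p : Prop :=
  [/\ (0 < size p)%N && walk G v p, walk_end v p = v, uniq (unzip2 p) & uniq (unzip1 p)].

Lemma closed_walk_cycle v p : closed_walk v p -> is_cycle G [set:: unzip1 p].
Proof. by case=> *; constructor 1; exists v, p. Qed.

Lemma closed_walk_start v p : closed_walk v p -> v \in unzip2 p.
Proof.
case=> /andP[]; case: p => [//|[e y] p] _ _; rewrite /walk_end /= => ev _ _.
by rewrite -{1}ev mem_last.
Qed.

Lemma closed_walk_vertices v p : closed_walk v p ->
  vertices G [set:: unzip1 p] = [set:: unzip2 p].
Proof.
move=> cl; have vp := closed_walk_start cl; case: (cl) => /andP[_ w] _ _ _.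
apply/setP=> z; rewrite !inE; apply/existsP/idP => [[e]|/mapP[[e y] ep /= ->]].
  rewrite inE => /andP[ep ze]; have := walk_incident w ep ze.
  by rewrite inE => /orP[/eqP ->|].
exists e; rewrite inE; apply/andP; split; first by apply/mapP; exists (e, y).
case/splitPr: ep w => p1 p2; rewrite walk_cat /= => /and3P[_ j _].
by rewrite (joins_incident _ j) eqxx orbT.
Qed.

Lemma split_at p y : y \in unzip2 p -> exists p1 e p2, p = rcons p1 (e, y) ++ p2.
Proof.
case/mapP=> -[e z] ep /= ->; case/splitPr: ep => p1 p2.
by exists p1, e, p2; rewrite cat_rcons.
Qed.

Lemma closed_walk_rot v p y : closed_walk v p -> y \in unzip2 p ->
  exists q, closed_walk y q /\ perm_eq (unzip1 q) (unzip1 p).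
Proof.
move=> [/andP[_ w] end_p u2 u1] /split_at[p1 [e [p2 Ep]]].
exists (p2 ++ rcons p1 (e, y)); move: w end_p u2 u1; rewrite Ep.
rewrite walk_cat walk_end_cat walk_end_rcons => /andP[w1 w2] e2.
rewrite /unzip1 /unzip2 !map_cat uniq_catC => u2 u1.
split; last by rewrite perm_catC.
split=> //.
- by rewrite size_cat size_rcons addnS /= walk_cat w2 e2 w1.
- by rewrite walk_end_cat e2 walk_end_rcons.
- by rewrite /unzip2 map_cat.
by rewrite /unzip1 map_cat uniq_catC.
Qed.

Lemma set_perm (s t : seq E) : perm_eq s t -> [set:: s] = [set:: t].
Proof. by move=> st; apply/setP=> e; rewrite !inE (perm_mem st). Qed.

(** A closed walk can be rotated to start at any of its vertices; a loose edge drops out because it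
    has no vertex. *)
Lemma cycle_at C x : is_cycle G C -> x \in vertices G C ->
  (exists e, G e = Half x /\ C = [set e]) \/
  (exists p, closed_walk x p /\ C = [set:: unzip1 p]).
Proof.
case=> [[v [p [wp ep u2 u1 ->]]]|[e [v [Ge ->]]]|[e [Ge ->]]].
- have cl : closed_walk v p by [].
  rewrite (closed_walk_vertices cl) inE => /(closed_walk_rot cl)[q [clq pq]].
  by right; exists q; split=> //; apply/esym/set_perm.
- rewrite inE => /existsP[f]; rewrite inE => /andP[/eqP ->]; rewrite /incident Ge.
  by move/eqP=> ->; left; exists e.
by rewrite inE => /existsP[f]; rewrite inE => /andP[/eqP ->]; rewrite /incident Ge.
Qed.

End Walks.

(** * Incidence vectors of signed graphs *)

Section IncidenceVectors.
Variables (F : fieldType) (V E : finType) (G : graph V E) (neg : pred E).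
Implicit Types (u v w x y z : V) (e f : E) (p q : seq (E * V)) (C D X : {set E}).
Implicit Types (c : E -> F).

Definition sgn (b : bool) : F := (-1) ^+ b.

(** The incidence matrix of a signed graph: a positive link gives a - b, a negative one a + b, a
    negative loop 2a, a half-edge a, while positive loops and loose edges give 0. *)
Definition inc (e : E) (x : V) : F :=
  match G e with
  | Ends a b => (x == a)%:R - sgn (neg e) * (x == b)%:R
  | Half a => (x == a)%:R
  | Loose => 0
  end.

Lemma sgn_neq0 b : sgn b != 0. Proof. by rewrite /sgn signr_eq0. Qed.

Lemma sgnM b b' : sgn (b (+) b') = sgn b * sgn b'.
Proof. by rewrite /sgn signr_addb. Qed.

Lemma sgnK b : sgn b * sgn b = 1.
Proof. by rewrite -sgnM addbb. Qed.

Lemma inc_incident e x : inc e x != 0 -> incident G x e.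
Proof.
rewrite /inc /incident; case: (G e) => [a b|a|]; last by rewrite eqxx.
  by case: (x == a); case: (x == b); rewrite ?mulr0 ?subrr ?eqxx.
by case: (x == a); rewrite ?eqxx.
Qed.

Lemma inc0 e x : ~~ incident G x e -> inc e x = 0.
Proof. by move=> h; apply/eqP; apply: contraNT h; apply: inc_incident. Qed.

Lemma inc_joins e x y : joins G e x y -> exists2 k : F, k != 0 &
  forall z, k * inc e z = (z == x)%:R - sgn (neg e) * (z == y)%:R.
Proof.
case/joinsP=> Ge; rewrite /inc Ge.
  by exists 1 => [|z]; rewrite ?oner_eq0 ?mul1r.
exists (- sgn (neg e)) => [|z]; first by rewrite oppr_eq0 sgn_neq0.
by rewrite mulNr mulrBr mulrA sgnK mul1r opprB.
Qed.

Lemma link_inc_neq0 e x y : joins G e x y -> x != y -> inc e x != 0.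
Proof.
move=> j xy; have [k k0 /(_ x)] := inc_joins j.
rewrite eqxx (negPf xy) mulr0 subr0 => E1; apply: contra_eq_neq E1 => ->.
by rewrite mulr0 eq_sym oner_eq0.
Qed.

Definition parity p : bool := \big[addb/false]_(e <- unzip1 p) neg e.

(** Each step, scaled by the product of the signs before it, cancels the contribution of its
    predecessor at their common vertex. On a closed walk the total is 0 if the walk is positive and
    twice the vector of its start if it is negative. *)
Lemma walk_comb u p : walk G u p -> uniq (unzip1 p) ->
  exists c, (forall e, (c e != 0) = (e \in unzip1 p)) /\
    forall x, comb inc c x = (x == u)%:R - sgn (parity p) * (x == walk_end u p)%:R.
Proof.
elim: p u => [|[f v] p IH] u /=.
  exists (fun=> 0); split=> [e|x]; first by rewrite eqxx.
  rewrite /parity /= big_nil mul1r subrr /comb big1 // => e _; exact: mul0r.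
move=> /andP[j w] /andP[fN u1]; have [c [sc cx]] := IH v w u1.
have [k k0 kx] := inc_joins j.
exists (fun e => (if e == f then k else 0) + sgn (neg f) * c e); split=> [e|x].
  rewrite inE; have [->|_] /= := eqVneq e f.
    by have := sc f; rewrite (negPf fN) => /negbFE/eqP ->; rewrite mulr0 addr0.
  by rewrite add0r mulf_eq0 (negPf (sgn_neq0 _)) /= sc.
rewrite combD comb_delta kx cx /parity big_cons sgnM mulrBr addrA subrK mulrA.
by [].
Qed.

(** The last vertex of the path meets only its last edge, which is therefore removed first. The
    relation may fail at u, so the path is independent even together with the vector of u. *)
Lemma path_indep u p c (X := [set:: unzip1 p]) : walk G u p -> uniq (u :: unzip2 p) ->
  supported X c -> (forall x, x != u -> comb inc c x = 0) -> forall e, c e = 0.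
Proof.
rewrite {}/X; elim/last_ind: p => [|p [f z] IH].
  by move=> _ _ sc _ e; apply: sc; rewrite inE.
rewrite walk_rcons /unzip1 /unzip2 !map_rcons -/(unzip1 p) -/(unzip2 p) -rcons_cons.
rewrite rcons_uniq => /andP[w j] /andP[zN up] sc h.
have zu : z != u by apply: contra zN => /eqP ->; rewrite mem_head.
have yz : z != walk_end u p by apply: contra zN => /eqP ->; apply: walk_end_mem.
have cf : c f = 0.
  have := h z zu; rewrite /comb (bigD1 f) //= big1 => [|e ef].
    rewrite addr0 => /eqP; rewrite mulf_eq0 => /orP[/eqP//|].
    by rewrite joins_sym in j; rewrite (negPf (link_inc_neq0 j yz)).
  have [ep|ep] := boolP (e \in unzip1 p); last first.
    by rewrite sc ?mul0r // inE mem_rcons inE negb_or ef.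
  by rewrite inc0 ?mulr0 //; apply: contra zN; apply: walk_incident.
apply: IH => // e; rewrite inE => ep.
have [->//|ef] := eqVneq e f.
by apply: sc; rewrite inE mem_rcons inE negb_or ef.
Qed.

(** A relation that vanishes at one edge of a cycle lives on the remaining path, where [path_indep]
    makes it zero. *)
Lemma closed_walk_dep_full v p c (X := [set:: unzip1 p]) : closed_walk G v p ->
  supported X c -> (forall x, comb inc c x = 0) -> (exists e, c e != 0) ->
  forall e, e \in X -> c e != 0.
Proof.
rewrite /X => cl sc z [e1 nz1] e; rewrite inE => ep; apply/negP=> /eqP ce.
have [y yp] : exists y, (e, y) \in p by case/mapP: ep => -[? y] ? /= ->; exists y.
have y2 : y \in unzip2 p by apply/mapP; exists (e, y).
case/splitPr: yp cl sc => p1 p2 [/andP[_ w] endp u2 u1] sc.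
move: (w) (endp) (u2) (u1); rewrite walk_cat walk_end_cat /= => /and3P[w1 j w2].
have -> : walk_end (walk_end v p1) ((e, y) :: p2) = walk_end y p2 by [].
move=> e2; rewrite /unzip1 /unzip2 !map_cat !(uniq_catC (map _ p1)) /= => /andP[yN u2'].
move=> /andP[eN u1'].
case/eqP: nz1; apply: (@path_indep y (p2 ++ p1)) => //.
- by rewrite walk_cat w2 e2 w1.
- by rewrite /= /unzip2 map_cat yN.
move=> t; rewrite inE /unzip1 map_cat => tN.
have [->//|te] := eqVneq t e; apply: sc.
rewrite inE /unzip1 map_cat mem_cat inE (negPf te) /= -mem_cat.
by rewrite mem_cat orbC -mem_cat.
Qed.

Definition cycle_parity C : bool := \big[addb/false]_(e in C) neg e.

Lemma cycle_parityE p : uniq (unzip1 p) -> cycle_parity [set:: unzip1 p] = parity p.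
Proof.
move=> up; rewrite /parity /cycle_parity big_uniq //=.
by apply: eq_bigl => e; rewrite inE.
Qed.

Hypothesis half_neg : forall e v, G e = Half v -> neg e.
Hypothesis loose_pos : forall e, G e = Loose -> ~~ neg e.

Lemma positive_cycle_dep C : is_cycle G C -> ~~ cycle_parity C -> dep inc C.
Proof.
case=> [[v [p [/andP[sp w] ep u2 u1 ->]]]|[e [v [Ge ->]]]|[e [Ge ->]]].
- rewrite cycle_parityE // => pos; have [c [sc cx]] := walk_comb w u1.
  exists c; split.
  + by move=> e; rewrite inE -sc negbK => /eqP.
  + by case: p sp {w ep u2 u1 pos cx} sc => // -[e y] p _ sc; exists e; rewrite sc mem_head.
  by move=> x; rewrite cx ep (negPf pos) mul1r subrr.
- by rewrite /cycle_parity big_set1 (half_neg Ge).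
move=> _; exists (fun t => if t == e then 1 else 0); split.
- by move=> t; rewrite inE => /negPf ->.
- by exists e; rewrite eqxx oner_eq0.
by move=> x; rewrite comb_delta /inc Ge mulr0.
Qed.

(** Going once round the cycle from x produces twice the vector of x; this is where the
    characteristic must differ from 2. *)
Lemma negative_cycle_comb C x : (2%:R : F) != 0 -> is_cycle G C -> cycle_parity C ->
  x \in vertices G C ->
  exists c, (forall e, (c e != 0) = (e \in C)) /\ forall z, comb inc c z = (z == x)%:R.
Proof.
move=> two cC par xC; case: (cycle_at cC xC) => [[e [Ge ->]]|[p [cl CE]]].
  exists (fun t => if t == e then 1 else 0); split=> [t|z].
    by rewrite in_set1; case: (t == e); rewrite ?oner_eq0 ?eqxx.
  by rewrite comb_delta /inc Ge mul1r.
case: (cl) => /andP[_ w] ep u2 u1; have [c [sc cx]] := walk_comb w u1.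
move: par; rewrite CE cycle_parityE // => par.
exists (fun e => 0 + 2%:R^-1 * c e); split=> [t|z].
  by rewrite inE add0r mulf_eq0 invr_eq0 (negPf two) /= sc.
rewrite combD cx ep par /sgn expr1 mulN1r opprK -mulr2n -(mulr_natl (z == x)%:R).
by rewrite mulKf // /comb big1 ?add0r // => e _; rewrite mul0r.
Qed.

Lemma negative_cycle_indep C c : (2%:R : F) != 0 -> is_cycle G C -> cycle_parity C ->
  supported C c -> (forall x, comb inc c x = 0) -> forall e, c e = 0.
Proof.
move=> two cC par sc z e; apply/eqP/negPn/negP=> ce.
have eC : e \in C by apply: contraR ce => /sc ->.
case: (cC) => [[v [p [w ep u2 u1 CE]]]|[f [v [Gf CE]]]|[f [Gf CE]]]; last first.
- by move: par; rewrite CE /cycle_parity big_set1 (negPf (loose_pos Gf)).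
- move: eC; rewrite CE inE => /eqP ef; have := z v.
  rewrite /comb (bigD1 f) //= big1 => [|t tf].
    by rewrite /inc Gf eqxx mulr1 addr0 -ef => ce0; rewrite ce0 eqxx in ce.
  by rewrite sc ?mul0r // CE inE.
have cl : closed_walk G v p by [].
have vC : v \in vertices G C.
  by rewrite CE (closed_walk_vertices cl) inE (closed_walk_start cl).
have [c' [sc' cx']] := negative_cycle_comb two cC par vC.
(* Subtracting a multiple of c from c' kills the last edge of the walk, which leaves a path. *)
case/andP: w => sp w.
case/lastP: p sp w ep u2 u1 CE cl => [//|p [f z']] _ + + + + CE cl.
rewrite walk_end_rcons walk_rcons => /andP[w j] z'v; subst z'.
rewrite /unzip1 /unzip2 !map_rcons !rcons_uniq -/(unzip1 p) -/(unzip2 p).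
move=> /andP[vN u2] /andP[fN u1].
have fC : f \in C by rewrite CE inE /unzip1 map_rcons mem_rcons mem_head.
have cf : c f != 0.
  apply: (closed_walk_dep_full cl _ z) => //; first by rewrite -CE.
  - by exists e.
  by rewrite -CE.
pose k := c' f / c f.
have zero : forall t, c' t - k * c t = 0.
  apply: (@path_indep v p) => //; first by rewrite /= vN.
    move=> t; rewrite inE => tp.
    have [->|tf] := eqVneq t f; first by rewrite /k divfK ?subrr.
    have tC : t \notin C by rewrite CE inE /unzip1 map_rcons mem_rcons inE negb_or tf.
    rewrite sc // mulr0 subr0; apply/eqP; move: (sc' t); rewrite (negPf tC).
    by move/negbFE.
  by move=> x /negPf xv; rewrite combB cx' z xv mulr0 subr0.
have := cx' v; rewrite eqxx => E1; have := combB inc c' c k v.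
rewrite E1 z mulr0 subr0 /comb big1 => [/eqP|t _]; last by rewrite zero mul0r.
by rewrite eq_sym oner_eq0.
Qed.

End IncidenceVectors.

(** * Cycles and ears in the support of a linear relation *)

Section DependentSets.
Variables (F : fieldType) (V E : finType) (G : graph V E) (neg : pred E).
Implicit Types (u v w x y z : V) (e f : E) (p q : seq (E * V)) (C D X : {set E}).
Implicit Types (W : {set V}).
Implicit Types (c : E -> F).

Notation vec := (inc F G neg).

Lemma walk_step u p e y : walk G u p -> (e, y) \in p -> incident G y e.
Proof.
move=> w ep; case/splitPr: ep w => p1 p2; rewrite walk_cat /= => /and3P[_ j _].
by rewrite (joins_incident _ j) eqxx orbT.
Qed.

Lemma walk_edge u p e : walk G u p -> e \in unzip1 p -> exists2 y, y \in unzip2 p & incident G y e.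
Proof.
move=> w /mapP[[e' y] ep ->]; exists y; last exact: walk_step w ep.
by apply/mapP; exists (e', y).
Qed.

Lemma incident_loop_or_link f z : incident G z f ->
  [\/ G f = Half z, G f = Ends z z | exists2 y, y != z & joins G f z y].
Proof.
rewrite /incident; case Gf: (G f) => [a b|a|] //.
  case/orP=> /eqP E1; subst z.
    have [->|ba] := eqVneq b a; [by constructor 2|constructor 3; exists b => //].
    by apply/joinsP; left.
  have [->|ba] := eqVneq a b; [by constructor 2|constructor 3; exists a => //].
  by apply/joinsP; right.
by move/eqP=> ->; constructor 1.
Qed.

Lemma loop_cycle f z : G f = Half z \/ G f = Ends z z ->
  is_cycle G [set f] /\ vertices G [set f] = [set z].
Proof.
move=> H; split.
  case: H => Gf; [constructor 2; by exists f, z | constructor 1; exists z, [:: (f, z)]].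
  split=> //; first by rewrite /= /joins Gf eqxx.
  by apply/setP=> t; rewrite !inE.
apply/setP=> x; rewrite !inE; apply/existsP/idP => [[t]|/eqP ->].
  by rewrite !inE => /andP[/eqP ->]; rewrite /incident; case: H => -> //; rewrite orbb.
by exists f; rewrite inE eqxx /incident; case: H => ->; rewrite eqxx.
Qed.

Lemma other_edge c z e : comb vec c z = 0 -> c e != 0 -> vec e z != 0 ->
  exists f, [/\ f != e, c f != 0 & incident G z f].
Proof.
move=> z0 ce ez; apply: NNPP => no.
move/eqP: z0; rewrite /comb (bigD1 e) //= big1 ?addr0 => [|f fe].
  by rewrite mulf_eq0 (negPf ce) (negPf ez).
apply/eqP; rewrite mulf_eq0; apply/norP => -[cf fz]; apply: no.
by exists f; split=> //; apply: inc_incident fz.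
Qed.

(* A longest walk that leaves W by e0 and stays off W either can be prolonged into W or
   closes up a cycle at its end: at every vertex off W two edges of the support of c meet. *)
Lemma ear c W w w1 e0 : (forall x, x \notin W -> comb vec c x = 0) -> w \in W ->
  c e0 != 0 -> joins G e0 w w1 -> w1 != w ->
  exists p, [/\ walk G w p, (0 < size p)%N, forall e, e \in unzip1 p -> c e != 0,
                uniq (unzip2 p) & uniq (unzip1 p)] /\
    [/\ forall e, e \in unzip1 p -> e = e0 \/ exists2 x, x \notin W & incident G x e &
      walk_end w p \in W /\ (forall x, x \in unzip2 p -> x \in W -> x = walk_end w p) \/
      (forall x, x \in unzip2 p -> x \notin W) /\
      exists D, [/\ is_cycle G D, forall e, e \in D -> c e != 0,
        forall x, x \in vertices G D -> x \notin W &
        vertices G D :&: [set:: unzip2 p] = [set walk_end w p]]].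
Proof.
move=> z0 wW ce0 j0 w1w.
have [w1W|w1W] := boolP (w1 \in W).
  exists [:: (e0, w1)]; rewrite /= j0; split; split=> //.
  - by move=> e; rewrite inE => /eqP ->.
  - by move=> e; rewrite inE => /eqP ->; left.
  by left; split=> // x; rewrite inE => /eqP.
(* Induction on the room left: w and the vertices of the walk are distinct, so the walk is shorter
   than the number of vertices. *)
have main n p : (#|V| - size p <= n)%N -> (0 < size p)%N -> walk G w p ->
    (forall e, e \in unzip1 p -> c e != 0) -> uniq (unzip2 p) ->
    (forall x, x \in unzip2 p -> x \notin W) ->
    exists p, [/\ walk G w p, (0 < size p)%N, forall e, e \in unzip1 p -> c e != 0,
                uniq (unzip2 p) & uniq (unzip1 p)] /\
    [/\ forall e, e \in unzip1 p -> e = e0 \/ exists2 x, x \notin W & incident G x e &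
      walk_end w p \in W /\ (forall x, x \in unzip2 p -> x \in W -> x = walk_end w p) \/
      (forall x, x \in unzip2 p -> x \notin W) /\
      exists D, [/\ is_cycle G D, forall e, e \in D -> c e != 0,
        forall x, x \in vertices G D -> x \notin W &
        vertices G D :&: [set:: unzip2 p] = [set walk_end w p]]].
  elim: n p => [|n IH] p ltn sp wp cp u2 pW.
    have upath : uniq (w :: unzip2 p) by rewrite /= u2 (contraTN (pW w)).
    have := card_uniqP upath; rewrite /= size_map => cardp.
    have := max_card (mem (w :: unzip2 p)); rewrite cardp => lt.
    by move: ltn; rewrite leqn0 subn_eq0 leqNgt lt.
  have wN : w \notin unzip2 p by apply: contraTN wW => /pW.
  have upath : uniq (w :: unzip2 p) by rewrite /= wN.
  have u1 := path_uniq_edges wp upath.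
  have touch e : e \in unzip1 p -> e = e0 \/ exists2 x, x \notin W & incident G x e.
    by move=> /(walk_edge wp)[x /pW xW xe]; right; exists x.
  case/lastP: p sp ltn wp cp u2 pW wN upath u1 touch =>
    [//|p [e z]] sp ltn wp cp u2 pW wN upath u1 touch.
  set P := rcons p (e, z) in sp ltn wp cp u2 pW wN upath u1 touch *.
  have endP : walk_end w P = z by rewrite walk_end_rcons.
  have zP : z \in unzip2 P by rewrite /unzip2 map_rcons mem_rcons mem_head.
  have zW := pW z zP.
  have [wp' j] : walk G w p /\ joins G e (walk_end w p) z by apply/andP; rewrite -walk_rcons.
  have zNp : z \notin w :: unzip2 p.
    by move: upath; rewrite /unzip2 map_rcons -rcons_cons rcons_uniq => /andP[].
  have ez : vec e z != 0.
    rewrite joins_sym in j; apply: link_inc_neq0 j _.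
    by apply: contra zNp => /eqP ->; apply: walk_end_mem.
  have eP : e \in unzip1 P by rewrite /unzip1 map_rcons mem_rcons mem_head.
  have [f [fe cf zf]] := other_edge (z0 z zW) (cp e eP) ez.
  have fP : f \notin unzip1 P.
    rewrite /unzip1 map_rcons mem_rcons inE negb_or fe.
    by apply: contra zNp => /(walk_incident wp'); apply.
  clearbody P.
  have loopcase : G f = Half z \/ G f = Ends z z -> exists D, [/\ is_cycle G D,
      forall e, e \in D -> c e != 0, forall x, x \in vertices G D -> x \notin W &
      vertices G D :&: [set:: unzip2 P] = [set walk_end w P]].
    move=> /loop_cycle[cD vD]; exists [set f]; rewrite vD endP; split=> //.
    - by move=> t; rewrite inE => /eqP ->.
    - by move=> t; rewrite inE => /eqP ->.
    by apply/setP=> t; rewrite !inE; case: eqP => // ->.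
  case: (incident_loop_or_link zf) => [H|H|[y yz jf]].
  - by exists P; split=> //; split=> //; right; split=> //; apply: loopcase; left.
  - by exists P; split=> //; split=> //; right; split=> //; apply: loopcase; right.
  have [yW|yW] := boolP (y \in W).
    exists (rcons P (f, y)); rewrite walk_end_rcons walk_rcons wp endP jf size_rcons.
    rewrite /unzip1 /unzip2 !map_rcons -/(unzip1 P) -/(unzip2 P) !rcons_uniq fP u1 u2.
    split; split=> //.
    + by move=> t; rewrite mem_rcons inE => /orP[/eqP ->|/cp].
    + by rewrite andbT; apply: contraTN yW => /pW.
    + move=> t; rewrite mem_rcons inE => /orP[/eqP ->|/touch //].
      by right; exists z.
    left; split=> // x; rewrite mem_rcons inE => /orP[/eqP //|/pW xN xW].
    by rewrite xW in xN.
  have [yP|yP] := boolP (y \in unzip2 P); last first.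
    apply: (IH (rcons P (f, y))).
    + by rewrite size_rcons subnS; move: ltn; rewrite -ltnS; case: (_ - _)%N.
    + by rewrite size_rcons.
    + by rewrite walk_rcons wp endP.
    + by move=> t; rewrite /unzip1 map_rcons mem_rcons inE => /orP[/eqP ->|/cp].
    + by rewrite /unzip2 map_rcons rcons_uniq yP.
    by move=> t; rewrite /unzip2 map_rcons mem_rcons inE => /orP[/eqP ->|/pW].
  (* The edge f leads back to an earlier vertex y. The final segment [p2] closed by f is the cycle
     D, and the walk is cut at y. *)
  have [p1 [e1 [p2 PE]]] := split_at yP.
  move: wp endP cp u2 pW u1 touch fP; rewrite {}PE walk_cat walk_end_cat walk_end_rcons.
  set P1 := rcons p1 (e1, y) => /andP[w1' w2'] e2 cp u2 pW u1 touch fP.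
  have mem1 t : t \in unzip1 P1 -> t \in unzip1 (P1 ++ p2).
    by rewrite /unzip1 map_cat mem_cat => ->.
  have mem2 t : t \in unzip2 P1 -> t \in unzip2 (P1 ++ p2).
    by rewrite /unzip2 map_cat mem_cat => ->.
  have yP1 : y \in unzip2 P1 by rewrite /unzip2 map_rcons mem_rcons mem_head.
  move: (u2) (u1); rewrite /unzip2 /unzip1 !map_cat !cat_uniq.
  move=> /and3P[u21 /hasPn dj u22] /and3P[u11 _ u12].
  have clD : closed_walk G y (rcons p2 (f, y)).
    split.
    + by rewrite size_rcons walk_rcons w2' e2 jf.
    + by rewrite walk_end_rcons.
    + by rewrite /unzip2 map_rcons rcons_uniq u22 andbT; apply/negP=> /dj; rewrite /= yP1.
    rewrite /unzip1 map_rcons rcons_uniq u12 andbT; apply: contra fP => fp2.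
    by rewrite /unzip1 map_cat mem_cat fp2 orbT.
  exists P1; rewrite w1' /P1 size_rcons -/P1; split; split=> //.
  - by move=> t /mem1/cp.
  - by move=> t /mem1/touch.
  right; split; first by move=> t /mem2/pW.
  exists [set:: unzip1 (rcons p2 (f, y))]; split.
  - exact: closed_walk_cycle clD.
  - move=> t; rewrite inE /unzip1 map_rcons mem_rcons inE => /orP[/eqP ->//|tp].
    by apply: cp; rewrite /unzip1 map_cat mem_cat tp orbT.
  - move=> t; rewrite (closed_walk_vertices clD) inE /unzip2 map_rcons mem_rcons inE.
    case/orP=> [/eqP ->//|tp]; apply: pW.
    by rewrite /unzip2 map_cat mem_cat tp orbT.
  rewrite (closed_walk_vertices clD) walk_end_rcons; apply/setP=> t.
  rewrite !inE {1}/unzip2 map_rcons mem_rcons inE; have [->|ty] /= := eqVneq t y.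
    by rewrite yP1.
  by apply/negP=> /andP[/dj /negP].
apply: (main _ [:: (e0, w1)] (leqnn _)) => //=; first by rewrite j0.
- by move=> e; rewrite inE => /eqP ->.
by move=> x; rewrite inE => /eqP ->.
Qed.

(** An ear from the single vertex a either returns to a, and is then a cycle, or ends at a cycle
    avoiding a. *)
Lemma dep_cycle c : (forall x, comb vec c x = 0) -> (exists e, c e != 0) ->
  exists C, is_cycle G C /\ forall e, e \in C -> c e != 0.
Proof.
move=> z [e0 ce0]; case Ge: (G e0) => [a b|a|].
- have [ab|ab] := eqVneq a b.
    rewrite -ab in Ge.
    have [cD _] := loop_cycle (or_intror Ge); exists [set e0]; split=> // e.
    by rewrite inE => /eqP ->.
  have j : joins G e0 a b by apply/joinsP; left.
  have [||p [[w sp cp u2 u1] [_ [[eW _]|[_ [D [cD D0 _ _]]]]]]] :=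
      @ear c [set a] a b e0 (fun x _ => z x) _ ce0 j; rewrite ?inE // 1?eq_sym //.
    exists [set:: unzip1 p]; split; last by move=> e; rewrite inE => /cp.
    apply: (@closed_walk_cycle _ _ _ a); split=> //; first by rewrite sp.
    by move: eW; rewrite inE => /eqP.
  by exists D.
- have [cD _] := loop_cycle (or_introl Ge); exists [set e0]; split=> // e.
  by rewrite inE => /eqP ->.
exists [set e0]; split; last by move=> e; rewrite inE => /eqP ->.
by constructor 3; exists e0.
Qed.

End DependentSets.

(** * Circuits of signed graphs are the minimal dependent sets *)

Section SignedCircuits.
Variables (F : fieldType) (V E : finType) (S : signed_graph V E).
Hypothesis two : (2%:R : F) != 0.
Implicit Types (u v w x y z : V) (e f : E) (p q : seq (E * V)) (C D X : {set E}).

Notation G := (sgraph S).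
Notation vec := (inc F G (negative_edge S)).
Notation par := (cycle_parity (negative_edge S)).

Lemma set_sign_parity C : set_sign S C = (-1) ^+ par C.
Proof.
rewrite /set_sign /cycle_parity.
have sgnD (a b : bool) : ((-1) ^+ (a (+) b) : int) = (-1) ^+ a * (-1) ^+ b.
  by rewrite signr_addb.
have sgn0 : ((-1) ^+ false : int) = 1 by [].
by rewrite (big_morph (fun b : bool => (-1) ^+ b : int) sgnD sgn0).
Qed.

Lemma positive_cycleP C : positive_cycle S C <-> is_cycle G C /\ ~~ par C.
Proof. by rewrite /positive_cycle set_sign_parity; case: (par C); split=> -[]. Qed.

Lemma negative_cycleP C : negative_cycle S C <-> is_cycle G C /\ par C.
Proof. by rewrite /negative_cycle set_sign_parity; case: (par C); split=> -[]. Qed.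

Lemma signed_circuit_dep C : signed_circuit S C -> dep vec C.
Proof.
case=> [/positive_cycleP[cC pos]|[C1 [C2 [u [v [p]]]]]|[C1 [C2]]].
- exact: positive_cycle_dep (@half_negative _ _ S) _ cC pos.
- move=> /= [[/negative_cycleP[cC1 n1] /negative_cycleP[cC2 n2]] d12 [w ep up] [W1 W2] CE].
  have uC1 : u \in vertices G C1.
    by have : u \in [set u] by [rewrite inE]; rewrite -W1 inE => /andP[].
  have vC2 : v \in vertices G C2.
    by have : v \in [set v] by [rewrite inE]; rewrite -W2 inE => /andP[].
  have [c1 [s1 z1]] := negative_cycle_comb two cC1 n1 uC1.
  have [c2 [s2 z2]] := negative_cycle_comb two cC2 n2 vC2.
  have [cp [sp zp]] := walk_comb F (negative_edge S) w (path_uniq_edges w up).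
  set s := sgn F _ in zp.
  (* The first cycle gives u, the path gives u - s v and the second cycle gives v, so this
     combination vanishes. *)
  exists (fun e => (c1 e - 1 * cp e) - s * c2 e); split.
  + move=> e; rewrite CE !inE !negb_or => /andP[/andP[e1 e3] e2].
    move: (s1 e) (s2 e) (sp e); rewrite (negPf e1) (negPf e2) (negPf e3).
    by move=> /negbFE/eqP -> /negbFE/eqP -> /negbFE/eqP ->; rewrite !mulr0 !subr0.
  (* An edge of [C1] at u lies neither on the path, which meets [C1] only at u, nor in [C2]; its
     coefficient comes from [c1] alone. *)
  + move: (uC1); rewrite inE => /existsP[e /andP[e1 ue]]; exists e.
    have ep' : e \notin unzip1 p.
      apply/negP=> /(walk_edge w)[y yp ye]; move: up => /= /andP[/negP uN _]; apply: uN.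
      suff /set1P <- : y \in [set u] by [].
      rewrite -W1 !inE yp orbT; apply/existsP; exists e; exact/andP.
    have e2 : e \notin C2.
      apply/negP=> e2; have : u \in vertices G C1 :&: vertices G C2.
        by rewrite inE uC1 inE; apply/existsP; exists e; apply/andP.
      by rewrite d12 inE.
    move: (sp e) (s2 e); rewrite (negPf ep') (negPf e2) => /negbFE/eqP -> /negbFE/eqP ->.
    by rewrite !mulr0 !subr0 s1.
  by move=> x; rewrite !combB z1 zp z2 ep mul1r opprB addrA addrAC subrr add0r subrr.
move=> [[/negative_cycleP[cC1 n1] /negative_cycleP[cC2 n2]] ne /eqP/cards1P[u E12] CE].
have [uC1 uC2] : u \in vertices G C1 /\ u \in vertices G C2.
  by apply/andP; rewrite -in_setI E12 inE.
have [c1 [s1 z1]] := negative_cycle_comb two cC1 n1 uC1.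
have [c2 [s2 z2]] := negative_cycle_comb two cC2 n2 uC2.
exists (fun e => c1 e - 1 * c2 e); split.
+ move=> e; rewrite CE !inE !negb_or => /andP[e1 e2].
  move: (s1 e) (s2 e); rewrite (negPf e1) (negPf e2).
  by move=> /negbFE/eqP -> /negbFE/eqP ->; rewrite !mulr0 !subr0.
+ apply: NNPP => no; apply: ne; apply/setP=> e; rewrite -s1 -s2.
  have [|ne0] := eqVneq (c1 e - 1 * c2 e) 0; last by case: no; exists e.
  by rewrite mul1r => /subr0_eq ->.
by move=> x; rewrite combB z1 z2 mul1r subrr.
Qed.

(** In a theta graph the signs of the two cycles through p multiply to the sign of C, because p is
    counted twice. As C is negative, one of the two is positive: either p followed by the arc [q2],
    or the arc [Q] followed by p reversed. *)
Lemma theta_positive_cycle C w p : is_cycle G C -> par C -> w \in vertices G C ->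
  walk G w p -> uniq (unzip2 p) -> uniq (unzip1 p) ->
  (forall e, e \in unzip1 p -> e \notin C) ->
  walk_end w p \in vertices G C -> walk_end w p != w ->
  (forall x, x \in unzip2 p -> x \in vertices G C -> x = walk_end w p) ->
  exists D, [/\ is_cycle G D, ~~ par D & D \subset C :|: [set:: unzip1 p]].
Proof.
move=> cC nC wC wp u2 u1 pC; set z := walk_end w p => zC zw pW.
have [[e [Ge CE]]|[q [clq CE]]] := cycle_at cC wC.
  have [_ vC] := loop_cycle (or_introl Ge).
  by move: zC; rewrite CE vC inE (negPf zw).
have vC : vertices G C = [set:: unzip2 q] by rewrite CE (closed_walk_vertices clq).
have zq : z \in unzip2 q by rewrite vC inE in zC.
have [q1 [e [q2 qE]]] := split_at zq.
set Q := rcons q1 (e, z) in qE.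
have endQ u : walk_end u Q = z by rewrite walk_end_rcons.
have zQ : z \in unzip2 Q by rewrite /unzip2 map_rcons mem_rcons mem_head.
have sQ : (0 < size Q)%N by rewrite size_rcons.
clearbody Q.
case: clq => /andP[_]; rewrite qE walk_cat walk_end_cat endQ => /andP[wQ wq2] eq2.
rewrite /unzip2 /unzip1 !map_cat !cat_uniq.
move=> /and3P[uQ2 /hasPn dj2 uq2] /and3P[uQ1 /hasPn dj1 uq1].
have inC1 t : t \in unzip1 Q -> t \in C.
  by rewrite CE inE qE /unzip1 map_cat mem_cat => ->.
have inC2 t : t \in unzip1 q2 -> t \in C.
  by rewrite CE inE qE /unzip1 map_cat mem_cat orbC => ->.
have inV1 t : t \in unzip2 Q -> t \in vertices G C.
  by rewrite vC inE qE /unzip2 map_cat mem_cat => ->.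
have inV2 t : t \in unzip2 q2 -> t \in vertices G C.
  by rewrite vC inE qE /unzip2 map_cat mem_cat orbC => ->.
have wp2 : w \notin unzip2 p by apply: contra zw => /pW/(_ wC) ->.
have wq2' : w \in unzip2 q2.
  have := walk_end_mem z q2; rewrite eq2 inE => /orP[/eqP wz|//].
  by rewrite wz eqxx in zw.
have wQ' : w \notin unzip2 Q by have := dj2 _ wq2'.
have [r [wr er r1 r2]] := walk_rev wp.
have upath : uniq (w :: unzip2 p) by rewrite /= wp2.
move: r2 (upath); rewrite lastI rev_rcons /= -/(walk_end w p) -/z rcons_uniq => r2 /andP[zb ub].
have rmem x : x \in unzip2 r -> (x \in w :: unzip2 p) /\ x != z.
  rewrite r2 mem_rev => xb; split; first by rewrite lastI mem_rcons inE xb orbT.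
  by apply: contraNneq zb => <-.
have ur2 : uniq (unzip2 r) by rewrite r2 rev_uniq.
have clA : closed_walk G w (p ++ q2).
  have q2_gt0 : (0 < size q2)%N by case: (q2) wq2'.
  split.
  - by rewrite walk_cat wp wq2 size_cat addn_gt0 q2_gt0 orbT.
  - by rewrite walk_end_cat.
  - rewrite /unzip2 map_cat cat_uniq u2 uq2 andbT; apply/hasPn => x xq2 /=.
    apply/negP=> /pW/(_ (inV2 _ xq2)) xz.
    by have := dj2 _ xq2; rewrite /= xz zQ.
  rewrite /unzip1 map_cat cat_uniq u1 uq1 andbT; apply/hasPn => x xq2 /=.
  by apply: contraL (inC2 _ xq2) => /pC.
have clB : closed_walk G w (Q ++ r).
  split.
  - by rewrite walk_cat wQ endQ wr size_cat addn_gt0 sQ.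
  - by rewrite walk_end_cat endQ.
  - rewrite /unzip2 map_cat cat_uniq uQ2 ur2 andbT; apply/hasPn => x /rmem[+ xz] /=.
    rewrite inE => /orP[/eqP -> //|xp]; apply/negP=> /inV1 /(pW _ xp) xz'.
    by rewrite xz' eqxx in xz.
  rewrite /unzip1 map_cat cat_uniq uQ1 /= -/(unzip1 r) r1 rev_uniq u1 andbT.
  by apply/hasPn => x /=; rewrite mem_rev => xp; apply: contraL (pC _ xp) => /inC1 ->.
have sumAB : parity (negative_edge S) (p ++ q2) (+) parity (negative_edge S) (Q ++ r) = true.
  have := nC; rewrite CE cycle_parityE; last first.
    by rewrite qE /unzip1 map_cat cat_uniq uQ1 uq1 andbT; apply/hasPn.
  move=> parC; rewrite -[RHS]parC qE /parity /unzip1 !map_cat !big_cat /=.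
  rewrite -/(unzip1 r) r1 (perm_big _ (_ : perm_eq (rev (unzip1 p)) (unzip1 p))) ?perm_rev //=.
  by rewrite -/(unzip1 p); do 3! case: (\big[_/_]_(_ <- _) _).
have [pA|pA] := boolP (parity (negative_edge S) (p ++ q2)); last first.
  exists [set:: unzip1 (p ++ q2)]; split; first exact: closed_walk_cycle clA.
    by rewrite cycle_parityE //; case: clA.
  apply/subsetP=> t; rewrite !inE /unzip1 map_cat mem_cat => /orP[->|/inC2 ->//].
  by rewrite orbT.
exists [set:: unzip1 (Q ++ r)]; split; first exact: closed_walk_cycle clB.
  by rewrite cycle_parityE; [move: sumAB; rewrite pA /=; case: parity | case: clB].
apply/subsetP=> t; rewrite !inE /unzip1 map_cat mem_cat -/(unzip1 r) r1 mem_rev.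
by move=> /orP[/inC1 ->|->]; rewrite ?orbT.
Qed.

(** A positive cycle in the support finishes the proof at once. Otherwise an ear leaves a negative
    cycle C at w: returning to w it gives a tight handcuff, returning elsewhere a theta graph and so
    a positive cycle, and ending at a cycle off C a loose handcuff. *)
Lemma dep_signed_circuit X : dep vec X -> exists2 C : {set E}, C \subset X & signed_circuit S C.
Proof.
move=> [c [sc nz z]]; have inX (C : {set E}) : (forall e, e \in C -> c e != 0) -> C \subset X.
  by move=> h; apply/subsetP=> e /h; apply: contraR => /sc ->.
have pos (C : {set E}) : is_cycle G C -> ~~ par C -> (forall e, e \in C -> c e != 0) ->
    exists2 C : {set E}, C \subset X & signed_circuit S C.
  by move=> cC pC /inX sC; exists C => //; constructor 1; apply/positive_cycleP.
have [C [cC C0]] := dep_cycle z nz.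
have [nC|/pos] := boolP (par C); last exact.
have tight (D : {set E}) : is_cycle G D -> (forall e, e \in D -> c e != 0) ->
    (exists e, (e \in D) && (e \notin C)) -> #|vertices G C :&: vertices G D| = 1%N ->
    exists2 C : {set E}, C \subset X & signed_circuit S C.
  move=> cD D0 [e /andP[eD eC]] card1.
  have [nD|/pos] := boolP (par D); last exact.
  exists (C :|: D); first by rewrite subUset !inX.
  constructor 3; exists C, D; split=> //; first by split; apply/negative_cycleP.
  by move=> CD; rewrite CD eD in eC.
pose W := vertices G C.
(* If no other edge of the support touched C, the relation restricted to C would still be a
   relation, but a negative cycle is independent. *)
have [e0 [e0C ce0 [w wW we0]]] : exists e0, [/\ e0 \notin C, c e0 != 0 &
    exists2 w, w \in W & incident G w e0].
  apply: NNPP => no.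
  have [e eC] : exists e, e \in C.
    apply: NNPP => nex; move: nC; rewrite /cycle_parity big1 // => e eC.
    by case: nex; exists e.
  pose c' e := if e \in C then c e else 0.
  have /eqP[] := C0 e eC; have := @negative_cycle_indep F V E G (negative_edge S)
    (@loose_positive _ _ S) C c' two cC nC.
  move=> /(_ _ _ e); rewrite /c' eC; apply=> [t /negPf -> //|x].
  rewrite comb_restrict; have [xW|xW] := boolP (x \in W).
    rewrite -[RHS](z x) /comb [RHS](bigID (mem C)) /= [X in _ + X]big1 ?addr0 // => t tC.
    have [->|ct] := eqVneq (c t) 0; first by rewrite mul0r.
    rewrite inc0 ?mulr0 //; apply/negP=> xt; apply: no; exists t; split=> //.
    by exists x.
  rewrite big1 // => t tC; rewrite inc0 ?mulr0 //; apply: contra xW => xt.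
  by rewrite inE; apply/existsP; exists t; rewrite tC.
have single (D : {set E}) : is_cycle G D -> (forall e, e \in D -> c e != 0) ->
    (exists e, (e \in D) && (e \notin C)) -> vertices G D :&: W = [set w] ->
    exists2 C : {set E}, C \subset X & signed_circuit S C.
  by move=> cD D0 eD E1; apply: (tight D) => //; rewrite setIC E1 cards1.
have loopcase : G e0 = Half w \/ G e0 = Ends w w ->
    exists2 C : {set E}, C \subset X & signed_circuit S C.
  move=> /loop_cycle[cD vD]; apply: (single [set e0]) => //.
  - by move=> t; rewrite inE => /eqP ->.
  - by exists e0; rewrite inE eqxx.
  by rewrite vD; apply/setIidPl; rewrite sub1set.
case: (incident_loop_or_link we0) => [H|H|[y yw j]].
- by apply: loopcase; left.
- by apply: loopcase; right.
have [p [[wp sp cp u2 u1] [touch fin]]] := ear (fun x _ => z x) wW ce0 j yw.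
have pC e : e \in unzip1 p -> e \notin C.
  case/touch=> [-> //|[x xW xe]]; apply: contra xW => eC.
  by rewrite inE; apply/existsP; exists e; rewrite eC.
case: fin => [[endW pW]|[pW [D [cD D0 DW Dp]]]].
  have [endw|endw] := eqVneq (walk_end w p) w.
    have cl : closed_walk G w p by split=> //; apply/andP.
    apply: (single [set:: unzip1 p]).
    - exact: closed_walk_cycle cl.
    - by move=> e; rewrite inE => /cp.
    - case: p sp {wp cp u2 u1 touch endW pW endw cl} pC => [//|[e y'] p] _ pC.
      by exists e; rewrite inE mem_head pC ?mem_head.
    rewrite (closed_walk_vertices cl); apply/setP=> x; rewrite !inE.
    apply/andP/eqP=> [[xp xW]|->]; first by rewrite -endw; apply: pW => //; rewrite inE.
    split; first exact: closed_walk_start cl.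
    by move: wW; rewrite inE.
  have [D [cD pD sD]] := theta_positive_cycle cC nC wW wp u2 u1 pC endW endw pW.
  apply: (pos D) => // e /(subsetP sD); rewrite !inE => /orP[/C0//|/cp //].
have [nD|/pos] := boolP (par D); last exact.
have wNp : w \notin unzip2 p by apply: contraTN wW => /pW.
have endp : walk_end w p \in unzip2 p.
  case: (p) sp => [//|[e y'] p'] _; rewrite /walk_end /=; exact: mem_last.
exists (C :|: [set:: unzip1 p] :|: D).
  by rewrite !subUset !inX // => e; rewrite inE => /cp.
constructor 2; exists C, D, w, (walk_end w p), p; split=> //.
- by split; apply/negative_cycleP.
- apply/setP=> x; rewrite in_setI in_set0; apply/negP=> /andP[xC /DW].
  by rewrite xC.
- by rewrite /= wNp.
split; apply/setP=> x; rewrite in_setI in_set1 in_set /= inE.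
  have [->|xw] := eqVneq x w; first by [].
  by apply/negP=> /andP[/pW /negP].
have [->|xw] /= := eqVneq x w.
  have /negPf -> : w \notin vertices G D by apply: contraTN wW => /DW.
  by apply/esym/negbTE; apply: contraNneq wNp => {1}->.
have := Dp => /setP/(_ x); rewrite in_setI in_set1 in_set => <-.
by rewrite andbC.
Qed.

Lemma signed_graphic_represents M : is_signed_graphic_matroid S M -> represents vec M.
Proof.
move=> [gM cM] X sX; split=> [/(indep_circuitP sX)[C /cM/signed_circuit_dep dC sC]|].
  exact: dep_mono dC.
by move=> /dep_signed_circuit[C sC /cM cC]; apply/(indep_circuitP sX); exists C.
Qed.

End SignedCircuits.

(** * Graphic restrictions *)

Section DirectDependence.
Variables (F : fieldType) (T I : finType) (v : T -> I -> F).

Lemma dep_direct (A B X : {set T}) : [disjoint A & B] -> direct v A B -> X \subset A :|: B ->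
  dep v X <-> dep v (X :&: A) \/ dep v (X :&: B).
Proof.
move=> dAB dir sX; split; last by case; apply: dep_mono; apply: subsetIl.
move=> [c [sc [e ce] z]].
have sAB : supported (A :|: B) c.
  by move=> t tAB; apply: sc; apply: contra tAB; apply: subsetP.
have part (D D' : {set T}) : D :|: D' = A :|: B -> [disjoint D & D'] -> direct v D D' ->
    e \in D -> dep v (X :&: D).
  move=> E1 dD dirD eD; exists (fun t => if t \in D then c t else 0); split.
  - by move=> t; rewrite inE; case: (t \in D); rewrite ?andbT // => /sc.
  - by exists e; rewrite eD.
  by move=> x; rewrite comb_restrict (dirD c) // E1.
have : e \in A :|: B by apply: contraR ce => /sAB ->.
rewrite inE => /orP[eA|eB]; [left|right].
  exact: (part A B).
apply: (part B A) => //; first by rewrite setUC.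
- by rewrite disjoint_sym.
- exact: direct_sym.
Qed.

End DirectDependence.

Section GraphicRestrictions.
Variables (T : finType).
Implicit Types (M N : matroid T) (X Y A B C D : {set T}).

Definition all_ends (V : finType) (G : graph V T) X :=
  forall e, e \in X -> exists u w, G e = Ends u w.

(** Stated through dependent sets, so that it passes to subsets at once and refers to no deletion;
    [graphic_deleteP] links it to [graphic]. *)
Definition graphic_on M X := exists (V : finType) (G : graph V T), all_ends G X /\
  forall X', X' \subset X -> X' \notin indep M <-> exists2 C : {set T}, C \subset X' & is_cycle G C.

(* The all-positive signature, except that a half-edge has to be negative. *)
Definition half_edges (V : finType) (G : graph V T) : pred T :=
  fun e => if G e is Half _ then true else false.

Section Incidence.
Variables (F : fieldType) (V : finType) (G : graph V T) (X : {set T}).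
Hypothesis GX : all_ends G X.
Notation vec := (inc F G (half_edges G)).

Lemma cycle_depP X' : X' \subset X ->
  (exists2 C : {set T}, C \subset X' & is_cycle G C) <-> dep vec X'.
Proof.
move=> sX; split=> [[C sC cC]|[c [sc nz z]]].
  apply: (dep_mono sC); apply: positive_cycle_dep => //.
  - by move=> e w; rewrite /half_edges => ->.
  rewrite /cycle_parity big1 // => e /(subsetP sC)/(subsetP sX)/GX[u [w]].
  by rewrite /half_edges => ->.
have [C [cC C0]] := dep_cycle z nz; exists C => //.
by apply/subsetP=> e /C0; apply: contraR => /sc ->.
Qed.

(** A relation carried by D is a relation on the closed walk C, hence has full support there. This
    is what turns the dependent-set form of graphicness back into one about circuits. *)
Lemma cycle_minimal C D : C \subset X -> is_cycle G C -> is_cycle G D -> D \subset C -> D = C.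
Proof.
move=> sC cC cD sDC; apply/eqP; rewrite eqEsubset sDC /=.
have sD := subset_trans sDC sC.
have [c [sc nz z]] : dep vec D by apply/cycle_depP => //; exists D.
case: (cC) => [[w [p [wp ep u2 u1 CE]]]|[e [w [Ge CE]]]|[e [Ge CE]]]; last first.
- by have [|u [w]] := GX (subsetP sC e _); rewrite ?CE ?inE // Ge.
- by have [|u [w']] := GX (subsetP sC e _); rewrite ?CE ?inE // Ge.
apply/subsetP=> e eC.
have scC : supported C c by move=> t tC; apply: sc; apply: contra tC; apply: subsetP.
have cl : closed_walk G w p by [].
rewrite CE in scC eC; have := closed_walk_dep_full cl scC z nz eC.
by apply: contraR => /sc ->.
Qed.

End Incidence.

Lemma graphic_on_sub M X Y : X \subset Y -> graphic_on M Y -> graphic_on M X.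
Proof.
move=> sXY [V [G [GY h]]]; exists V, G; split=> [e /(subsetP sXY)/GY //|X' sX'].
by apply: h; apply: subset_trans sXY.
Qed.

Lemma graphic_on0 M : graphic_on M set0.
Proof.
exists bool, (fun=> Ends true true); split=> [e|X']; first by rewrite inE.
rewrite subset0 => /eqP ->; rewrite indep0; split=> // -[C].
rewrite subset0 => /eqP -> [[v [p [/andP[sp _] _ _ _ /setP E1]]]|[e [v [//]]]|[e [//]]].
by case: p sp E1 => // -[e y] p _ /(_ e); rewrite !inE eqxx.
Qed.

Lemma graphic_deleteP M Y : graphic (delete M Y) <-> graphic_on M (ground M :\: Y).
Proof.
have indE X : X \subset ground M :\: Y -> (X \in indep (delete M Y)) = (X \in indep M).
  by move=> sX; rewrite inE sX andbT.
split=> [[V [G [GX cG]]]|[V [G [GX h]]]]; exists V, G; split=> //.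
  move=> X' sX'; have P := @indep_circuitP _ (delete M Y) X' sX'.
  rewrite -indE //; split=> [/P[C /cG[sC cC] sCX]|[C sC cC]].
    by exists C.
  apply/P; exists C => //; apply/cG; split=> //.
  exact: subset_trans sX'.
move=> C; split=> [cC|[sC cC]].
  have [/= /andP[sC nC] minC] := minsetP cC; split=> //.
  have [D sDC cD] := (h C sC).1 (eq_ind _ (fun b => ~~ b) nC _ (indE C sC)).
  have sD := subset_trans sDC sC.
  have -> // : C = D.
  apply/esym/minC => //=; rewrite sD indE //; apply/(h D sD); by exists D.
have : C \notin indep (delete M Y) by rewrite indE //; apply/(h C sC); exists C.
move/(@indep_circuitP _ (delete M Y) C sC) => [D cD sDC].
have [/= /andP[sD nD] _] := minsetP cD.
have [D' sD' cD'] := (h D sD).1 (eq_ind _ (fun b => ~~ b) nD _ (indE D sD)).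
have E1 := @cycle_minimal 'F_2 V G _ GX C D' sC cC cD' (subset_trans sD' sDC).
suff -> : C = D by [].
by apply/eqP; rewrite eqEsubset sDC -E1 sD'.
Qed.

(** Oriented incidence vectors represent the cycle matroid over every field. The field is left free:
    F_3 serves the balanced sets, F_2 the graphs built from search trees. *)
Lemma graphic_on_incidence (F : fieldType) (V : finType) M X (a : T -> V * V) :
  (forall X', X' \subset X -> X' \notin indep M <->
     dep (fun e x => (x == (a e).1)%:R - (x == (a e).2)%:R : F) X') -> graphic_on M X.
Proof.
move=> h; pose G : graph V T := fun e => Ends (a e).1 (a e).2.
have GX : all_ends G X by move=> e _; exists (a e).1, (a e).2.
exists V, G; split=> // X' sX'; rewrite (cycle_depP F GX sX') h //.
by split=> -[c [sc nz z]]; exists c; split=> // x; rewrite -[RHS](z x);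
  apply: eq_bigr => e _; rewrite /inc /= mul1r.
Qed.

(** The disjoint union of the two graphs works: its incidence vectors split over the two summands of
    the vertex set exactly as v splits over A and B. *)
Lemma graphic_on_direct (F : fieldType) (I : finType) (v : T -> I -> F) M A B :
  represents v M -> A :|: B \subset ground M -> [disjoint A & B] -> direct v A B ->
  graphic_on M A -> graphic_on M B -> graphic_on M (A :|: B).
Proof.
move=> rM sAB dAB dir [V1 [G1 [e1 h1]]] [V2 [G2 [e2 h2]]].
pose im (V V' : Type) (g : V -> V') (i : incidence V) : incidence V' :=
  match i with Ends a b => Ends (g a) (g b) | Half a => Half (g a) | Loose => Loose end.
pose G : graph (V1 + V2)%type T :=
  fun e => if e \in A then im _ _ inl (G1 e) else im _ _ inr (G2 e).
have BA e : e \in B -> (e \in A) = false by move=> eB; rewrite (disjointFl dAB eB).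
have GX : all_ends G (A :|: B).
  move=> e; rewrite inE => /orP[eA|eB]; rewrite /G ?eA ?(BA e eB).
    by have [u [w ->]] := e1 e eA; exists (inl u), (inl w).
  by have [u [w ->]] := e2 e eB; exists (inr u), (inr w).
pose g1 := inc F G1 (half_edges G1); pose g2 := inc F G2 (half_edges G2).
pose g := inc F G (half_edges G).
have gAl e x : e \in A -> g e (inl x) = g1 e x.
  by move=> eA; have [u [w Ge]] := e1 e eA; rewrite /g /g1 /inc /half_edges /G eA Ge.
have gAr e x : e \in A -> g e (inr x) = 0.
  move=> eA; have [u [w Ge]] := e1 e eA; rewrite /g /inc /half_edges /G eA Ge /=.
  by rewrite mulr0 subr0.
have gBr e x : e \in B -> g e (inr x) = g2 e x.
  by move=> eB; have [u [w Ge]] := e2 e eB; rewrite /g /g2 /inc /half_edges /G BA // Ge.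
have gBl e x : e \in B -> g e (inl x) = 0.
  move=> eB; have [u [w Ge]] := e2 e eB; rewrite /g /inc /half_edges /G BA // Ge /=.
  by rewrite mulr0 subr0.
have dirg : direct g A B.
  apply: (@direct_support _ _ _ _ [set x : V1 + V2 | if x is inl _ then true else false]) => //.
  - by move=> e [x|x] eA; rewrite inE // => _; apply: gAr.
  - by move=> e [x|x] eB; rewrite inE // => _; apply: gBl.
have depA X : X \subset A -> dep g X <-> dep g1 X.
  move=> sX; split=> [[c [sc nz z]]|[c [sc nz z]]]; exists c; split=> //;
    [move=> x | case=> x].
  - rewrite -[RHS](z (inl x)) !(comb_in _ _ sc); apply: eq_bigr => e /(subsetP sX) eA.
    by rewrite gAl.
  - rewrite -[RHS](z x) !(comb_in _ _ sc); apply: eq_bigr => e /(subsetP sX) eA.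
    by rewrite gAl.
  by rewrite (comb_in _ _ sc) big1 // => e /(subsetP sX) eA; rewrite gAr ?mulr0.
have depB X : X \subset B -> dep g X <-> dep g2 X.
  move=> sX; split=> [[c [sc nz z]]|[c [sc nz z]]]; exists c; split=> //;
    [move=> x | case=> x].
  - rewrite -[RHS](z (inr x)) !(comb_in _ _ sc); apply: eq_bigr => e /(subsetP sX) eA.
    by rewrite gBr.
  - by rewrite (comb_in _ _ sc) big1 // => e /(subsetP sX) eA; rewrite gBl ?mulr0.
  rewrite -[RHS](z x) !(comb_in _ _ sc); apply: eq_bigr => e /(subsetP sX) eA.
  by rewrite gBr.
exists (V1 + V2)%type, G; split=> // X sX.
have sXM := subset_trans sX sAB.
have indepP (Z D : {set T}) : D \subset A :|: B -> (Z :&: D \notin indep M) <-> dep v (Z :&: D).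
  by move=> sD; apply: rM; apply: subset_trans (subsetIr _ _) (subset_trans sD sAB).
rewrite (rM X sXM) (dep_direct dAB dir sX) (cycle_depP F GX sX) -/g (dep_direct dAB dirg sX).
rewrite (depA _ (subsetIr _ _)) (depB _ (subsetIr _ _)).
rewrite -(indepP X A (subsetUl _ _)) -(indepP X B (subsetUr _ _)).
rewrite (h1 _ (subsetIr _ _)) (h2 _ (subsetIr _ _)).
by rewrite (cycle_depP F e1 (subsetIr _ _)) (cycle_depP F e2 (subsetIr _ _)).
Qed.

End GraphicRestrictions.

(** * Depth-first search trees *)

(** The arguments on search trees and on the vertices of a set use signed graphs only through this
    property of their vectors. *)
Definition two_support (F : fieldType) (T V : finType) (v : T -> V -> F) := forall e x y z,
  v e x != 0 -> v e y != 0 -> v e z != 0 -> x != y -> z = x \/ z = y.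

Section NormalTree.
Variables (F : fieldType) (T V : finType) (v : T -> V -> F).
Variables (X : {set T}) (r : V).
Implicit Types (U K : {set V}) (P : V -> {set T}) (y : V -> F) (k : T -> F).

(* P a is the set of edges of the tree path from the root r to a, the unit y a is the
   switching making the tree positive, and k t rescales the edge t to y a - y b,
   b being the parent of a. *)
Record normal_tree U P y k : Prop := NormalTree {
  tree_root : r \in U /\ (P r = set0 /\ y r = 1);
  tree_scale : forall a, a \in U -> y a != 0;
  tree_sub : forall a t, a \in U -> t \in P a -> t \in X;
  tree_sum : forall a x, a \in U ->
    \sum_(t in P a) k t * v t x = y a * (x == a)%:R - (x == r)%:R;
  tree_coef : forall a t, a \in U -> t \in P a -> k t != 0;
  tree_normal : forall e a b, e \in X -> a \in U -> b \in U -> v e a != 0 -> v e b != 0 ->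
    P a \subset P b \/ P b \subset P a;
  tree_in : forall a t x, a \in U -> t \in P a -> x \notin U -> v t x = 0;
  tree_indep : forall c, supported (\bigcup_(a in U) P a) c ->
    (forall x, x != r -> comb v c x = 0) -> forall t, c t = 0;
  tree_edge : forall a, a \in U -> a != r ->
    exists2 t, t \in P a & forall b, b \in U -> t \in P b -> P a \subset P b
}.

Hypothesis two : two_support v.

(* The stack a :: s of the search contains all visited vertices with unvisited neighbours,
   so every neighbour of the new vertex d is an ancestor of d. *)
Lemma normal_tree_extend U P y k e a d s : normal_tree U P y k ->
  all (mem U) (a :: s) -> pairwise (fun a b => P b \subset P a) (a :: s) ->
  (forall e a' b, e \in X -> a' \in U -> b \notin U -> v e a' != 0 -> v e b != 0 ->
     a' \in a :: s) ->
  e \in X -> d \notin U -> v e a != 0 -> v e d != 0 ->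
  exists P' y' k', [/\ normal_tree (d |: U) P' y' k', forall b, b \in U -> P' b = P b &
    P a \subset P' d].
Proof.
move=> nt /= /andP[aU sU] /andP[/allP dec _] open eX dU ea ed.
have da : d != a by apply: contraNneq dU => ->.
have ad : a != d by rewrite eq_sym.
have Ud b : b \in U -> (b == d) = false by move=> bU; apply: contraNF dU => /eqP <-.
have eN b : b \in U -> e \notin P b.
  by move=> bU; apply: contraNN ed => eb; apply/eqP; apply: (tree_in nt bU eb).
(* This scale gives e the entry [- y a] at a, which cancels the end of the path sum of a and leaves
   only d and the root. *)
pose k0 := - y a / v e a; have k0N : k0 != 0.
  by rewrite /k0 mulf_neq0 ?invr_eq0 // oppr_eq0 (tree_scale nt).
pose P' b := if b == d then e |: P a else P b.
pose y' b := if b == d then k0 * v e d else y b.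
pose k' t := if t == e then k0 else k t.
have P'U b : b \in U -> P' b = P b by move=> bU; rewrite /P' Ud.
have y'U b : b \in U -> y' b = y b by move=> bU; rewrite /y' Ud.
have k'P b t : b \in U -> t \in P b -> k' t = k t.
  by move=> bU tb; rewrite /k'; case: eqP => // te; rewrite te (negPf (eN b bU)) in tb.
have P'd : P' d = e |: P a by rewrite /P' eqxx.
have y'd : y' d = k0 * v e d by rewrite /y' eqxx.
have rU : r \in U by case: (tree_root nt).
have vE x : v e x = v e a * (x == a)%:R + v e d * (x == d)%:R.
  have [->|xa] := eqVneq x a; first by rewrite (negPf ad) mulr1 mulr0 addr0.
  have [->|xd] := eqVneq x d; first by rewrite mulr1 mulr0 add0r.
  rewrite !mulr0 addr0; apply/eqP/negPn/negP=> ex.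
  by case: (two ea ed ex ad) => E1; rewrite E1 eqxx in xa xd.
have sumE b x : b \in U -> \sum_(t in P b) k' t * v t x = \sum_(t in P b) k t * v t x.
  by move=> bU; apply: eq_bigr => t tb; rewrite (k'P b).
exists P', y', k'; split; [split | exact: P'U | by rewrite P'd subsetUr].
- by rewrite !inE rU orbT P'U // y'U //; case: (tree_root nt).
- move=> b; rewrite !inE => /orP[/eqP ->|bU]; last by rewrite y'U ?(tree_scale nt).
  by rewrite y'd mulf_neq0.
- move=> b t; rewrite !inE => /orP[/eqP ->|bU]; last by rewrite P'U //; apply: (tree_sub nt bU).
  by rewrite P'd !inE => /orP[/eqP ->//|]; apply: (tree_sub nt aU).
- move=> b x; rewrite !inE => /orP[/eqP ->|bU]; last first.
    by rewrite P'U // y'U // sumE // (tree_sum nt).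
  rewrite P'd y'd big_setU1 ?eN //= sumE // (tree_sum nt) // /k' eqxx vE.
  have k0a : k0 * v e a = - y a by rewrite divfK.
  by rewrite mulrDr !mulrA k0a mulNr addrA [_ + y a * _]addrAC addNr add0r.
- move=> b t; rewrite !inE => /orP[/eqP ->|bU].
    rewrite P'd !inE /k'; case: eqP => //= _; exact: (tree_coef nt).
  by rewrite P'U // => tb; rewrite (k'P b) // (tree_coef nt bU tb).
- have half e' b : e' \in X -> b \in U -> v e' d != 0 -> v e' b != 0 -> P' b \subset P' d.
    move=> e'X bU e'd e'b; rewrite P'U // P'd.
    apply: subset_trans (subsetUr _ _).
    have := open e' b d e'X bU dU e'b e'd; rewrite inE => /orP[/eqP ->//|].
    exact: dec.
  move=> e' b b' e'X; rewrite !inE => /orP[/eqP ->|bU] /orP[/eqP ->|b'U] eb eb'.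
  + by left.
  + by right; apply: (half e').
  + by left; apply: (half e').
  by rewrite !P'U //; apply: (tree_normal nt e'X).
- move=> b t x; rewrite !inE => bdU tb; rewrite negb_or => /andP[xd xU].
  case/orP: bdU tb => [/eqP ->|bU]; last by rewrite P'U // => tb; apply: (tree_in nt bU tb).
  rewrite P'd !inE => /orP[/eqP ->|ta]; last exact: (tree_in nt aU ta).
  rewrite vE (negPf xd) mulr0 addr0; case: eqP => [E1|_]; last by rewrite mulr0.
  by rewrite E1 aU in xU.
- move=> c sc z.
  have sc' t : t != e -> t \notin \bigcup_(b in U) P b -> c t = 0.
    move=> te tN; apply: sc; apply: contra tN => /bigcupP[b + tb].
    rewrite !inE => /orP[/eqP bd|bU]; last first.
      by apply/bigcupP; exists b => //; rewrite -P'U.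
    by move: tb; rewrite bd P'd !inE (negPf te) => ta; apply/bigcupP; exists a.
  have dr : d != r by apply: contraNneq dU => ->.
  (* At the new vertex d, only e among the tree edges has a nonzero entry. *)
  have ce : c e = 0.
    have := z d dr; rewrite /comb (bigD1 e) //= big1 => [|t te].
      by rewrite addr0 => /eqP; rewrite mulf_eq0 (negPf ed) orbF => /eqP.
    have [/bigcupP[b bU tb]|tN] := boolP (t \in \bigcup_(b in U) P b).
      by rewrite (tree_in nt bU tb dU) mulr0.
    by rewrite sc' ?mul0r.
  apply: (tree_indep nt _ z) => t tN; have [->//|te] := eqVneq t e; exact: sc'.
move=> b; rewrite !inE => /orP[/eqP ->|bU] br.
  exists e; first by rewrite P'd setU11.
  move=> b'; rewrite !inE => /orP[/eqP ->//|b'U]; rewrite P'U // => eb.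
  by rewrite (negPf (eN b' b'U)) in eb.
have [t tb tP] := tree_edge nt bU br; exists t; first by rewrite P'U.
move=> b'; rewrite !inE => /orP[/eqP ->|b'U]; last by rewrite !P'U //; apply: tP.
rewrite P'd P'U // !inE => /orP[/eqP te|ta]; first by rewrite te (negPf (eN b bU)) in tb.
exact: subset_trans (tP a aU ta) (subsetUr _ _).
Qed.

Lemma normal_tree_exists K : r \in K ->
  (forall e x, e \in X -> v e x != 0 -> x \in K) ->
  (forall U, U \subset K -> r \in U -> U != K -> exists e x z,
     [/\ e \in X, x \in U, z \notin U, v e x != 0 & v e z != 0]) ->
  exists P y k, normal_tree K P y k.
Proof.
move=> rK XK conn.
(* The measure counts unvisited vertices twice and the stack once: a visit lowers it by 2 - 1, a pop
   by 1. *)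
have main n U P y k s : (2 * #|K :\: U| + size s <= n)%N -> U \subset K ->
    normal_tree U P y k -> all (mem U) s -> pairwise (fun a b => P b \subset P a) s ->
    (forall e a b, e \in X -> a \in U -> b \notin U -> v e a != 0 -> v e b != 0 -> a \in s) ->
    exists P y k, normal_tree K P y k.
  elim: n U P y k s => [|n IH] U P y k [|a s] len sUK nt sU dec open.
  - by exists P, y, k; rewrite -[K](_ : U = K) //; apply/eqP; apply/negPn/negP=> UK;
      case: (conn U sUK (tree_root nt).1 UK) => e [x [z [eX xU zU ex ez]]];
      have := open e x z eX xU zU ex ez.
  - by rewrite addnS in len.
  - by exists P, y, k; rewrite -[K](_ : U = K) //; apply/eqP; apply/negPn/negP=> UK;
      case: (conn U sUK (tree_root nt).1 UK) => e [x [z [eX xU zU ex ez]]];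
      have := open e x z eX xU zU ex ez.
  have [[e [d [eX dU ea ed]]]|no] :=
      classic (exists e d, [/\ e \in X, d \notin U, v e a != 0 & v e d != 0]).
    have [P' [y' [k' [nt' P'U Pd]]]] := normal_tree_extend nt sU dec open eX dU ea ed.
    have dK := XK e d eX ed.
    have aU : a \in U by case/andP: sU.
    apply: (IH (d |: U) P' y' k' (d :: a :: s)) => //.
    + have E1 : K :\: U = d |: (K :\: (d |: U)).
        apply/setP=> t; rewrite !inE; have [->|] //= := eqVneq t d.
        by rewrite dU dK.
      move: len; rewrite E1 cardsU1 !inE eqxx /= mulnDr muln1 /=.
      by rewrite !addnS !addSn add0n ltnS.
    + by rewrite subUset sub1set dK.
    + apply/allP=> b; rewrite in_cons /= in_setU1 => /orP[-> //|bs].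
      by have /= -> := allP sU _ bs; rewrite orbT.
    + have sameU b : b \in a :: s -> P' b = P b by move=> bs; apply: P'U; apply: (allP sU).
      rewrite pairwise_cons; apply/andP; split.
        apply/allP=> b bs; rewrite sameU //; apply: subset_trans Pd.
        move: bs dec; rewrite inE => /orP[/eqP ->//|bs] /= /andP[/allP/(_ b bs)] //.
      rewrite (@eq_in_pairwise _ (mem (a :: s)) _ (fun a b => P b \subset P a)) //.
        by move=> b b' bs b's /=; rewrite !sameU.
      by apply/allP.
    move=> e' b b' e'X; rewrite !inE negb_or => bdU /andP[b'd b'U] e'b e'b'.
    have [//|bd] := eqVneq b d; rewrite (negPf bd) /= in bdU.
    by have := open e' b b' e'X bdU b'U e'b e'b'; rewrite inE.
  apply: (IH U P y k s) => //.
  + by move: len; rewrite /= addnS.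
  + by case/andP: sU.
  + by case/andP: dec.
  move=> e b b' eX bU b'U eb eb'; have := open e b b' eX bU b'U eb eb'.
  rewrite inE => /orP[/eqP ba|//]; case: no; exists e, b'; split=> //.
  by rewrite -ba.
apply: (main _ [set r] (fun=> set0) (fun=> 1) (fun=> 0) [:: r] (leqnn _)) => //=.
- by rewrite sub1set.
- split.
  + by rewrite inE.
  + by move=> *; rewrite oner_eq0.
  + by move=> a t; rewrite !inE.
  + by move=> a x /set1P ->; rewrite big_set0 mul1r subrr.
  + by move=> a t _; rewrite inE.
  + by left.
  + by move=> a t x _; rewrite in_set0.
  + move=> c sc _ t; apply: sc; apply/negP=> /bigcupP[a _]; by rewrite inE.
  by move=> a /set1P ->; rewrite eqxx.
- by rewrite inE eqxx.
by move=> e a b _; rewrite !inE => ->.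
Qed.

End NormalTree.

(** * Graphs from depth-first search trees *)

Lemma F2_neq0 (x : 'F_2) : x != 0 -> x = 1.
Proof. by case: x => [[|[|n]] lt] //= _; apply: val_inj. Qed.

Lemma F2_addrr (x : 'F_2) : x + x = 0.
Proof. by case: x => [[|[|n]] lt] //; apply: val_inj. Qed.

Lemma F2_oppr (x : 'F_2) : - x = x.
Proof. by apply/eqP; rewrite eq_sym -addr_eq0 F2_addrr. Qed.

Lemma F3_eqN (x z : 'F_3) : x != 0 -> z != 0 -> x = z \/ x = - z.
Proof.
case: x z => [[|[|[|n]]] lt] [[|[|[|m]]] lt'] //= _ _;
  by [left; apply: val_inj | right; apply: val_inj].
Qed.

Section FundamentalCircuits.
Variables (T V I : finType) (v : T -> V -> 'F_3) (f : T -> I -> 'F_2) (M : matroid T).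
Hypotheses (rv : represents v M) (rf : represents f M).
Implicit Types (X Y Z : {set T}).

Lemma dep_transfer X : X \subset ground M -> dep v X <-> dep f X.
Proof. by move=> sX; rewrite -(rv sX) (rf sX). Qed.

(* A fundamental circuit has a unique dependency over either field, so its
   support over F_3 is also its support over F_2. *)
Lemma binary_expansion Z c lam e : Z \subset ground M -> ~ dep v Z -> e \in ground M ->
  lam != 0 -> supported Z c -> (forall x, comb v c x = lam * v e x) ->
  forall i, f e i = \sum_(t | c t != 0) f t i.
Proof.
move=> sZ nZ eM lam0 sc cx i.
have indepZ h : supported Z h -> (forall x, comb v h x = 0) -> forall t, h t = 0.
  by move=> sh hz t; apply: NNPP => ht; apply: nZ; exists h; split=> //; exists t; apply/eqP.
pose h t := (if t == e then lam else 0) - 1 * c t.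
have hz x : comb v h x = 0 by rewrite combB comb_delta cx mul1r subrr.
have [eZ|eZ] := boolP (e \in Z).
  have h0 : forall t, h t = 0.
    apply: indepZ => // t tZ; rewrite /h sc // mulr0 subr0.
    by case: eqP => // te; rewrite te eZ in tZ.
  rewrite (big_pred1 e) // => t; have := h0 t; rewrite /h mul1r => /subr0_eq <-.
  by rewrite /=; case: (t == e); rewrite ?lam0 ?eqxx.
have ce : c e = 0 := sc e eZ.
have sC : e |: [set t | c t != 0] \subset ground M.
  rewrite subUset sub1set eM; apply: subset_trans sZ; apply/subsetP=> t.
  by rewrite inE; apply: contraR => /sc ->.
have depC : dep v (e |: [set t | c t != 0]).
  exists h; split=> //.
    move=> t; rewrite !inE negb_or negbK /h => /andP[/negPf -> /eqP ->].
    by rewrite mulr0 subr0.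
  by exists e; rewrite /h eqxx ce mulr0 subr0.
(* The relation h over F_3 yields a relation d over F_2 inside its support, and d yields g over F_3
   inside the support of d. Uniqueness makes g proportional to h, so d has the full support of h,
   with all coefficients 1. *)
have [d [sd [t0 dt0] dz]] := (dep_transfer sC).1 depC.
have sD : [set t | d t != 0] \subset ground M.
  by apply: subset_trans sC; apply/subsetP=> t; rewrite inE; apply: contraR => /sd ->.
have cZ t : t \notin Z -> t != e -> t \notin e |: [set t | c t != 0].
  by move=> tZ te; rewrite !inE (negPf te) /= negbK (sc t tZ).
have depD : dep f [set t | d t != 0].
  exists d; split=> //; last by exists t0.
  by move=> t; rewrite inE negbK => /eqP.
have [g [sg [t1 gt1] gz]] := (dep_transfer sD).2 depD.
have ge : g e != 0.
  apply: contra_neq gt1 => ge; apply: indepZ => // t tZ.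
  have [->//|te] := eqVneq t e; apply: sg; rewrite inE negbK; apply/eqP/sd; exact: cZ.
have hg : forall t, h t - (lam / g e) * g t = 0.
  apply: indepZ => [t tZ|x]; last by rewrite combB hz gz mulr0 subrr.
  have [->|te] := eqVneq t e; first by rewrite /h eqxx ce mulr0 subr0 divfK // subrr.
  rewrite /h (negPf te) sc // mulr0 subrr (sg t) ?mulr0 ?subrr // inE negbK.
  by apply/eqP/sd; apply: cZ.
have dE t : d t = ((t == e) || (c t != 0))%:R.
  case: (boolP ((t == e) || (c t != 0))) => H; last first.
    by apply: sd; rewrite !inE.
  apply: F2_neq0; have : g t != 0.
    case/orP: H => [/eqP -> //|ct]; have [->//|te] := eqVneq t e.
    have := hg t; rewrite /h (negPf te) mul1r sub0r => /subr0_eq H.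
    by apply: contra_neq ct => gt0; apply/eqP; rewrite -oppr_eq0 H gt0 mulr0.
  by apply: contraNN => dt; apply/eqP/sg; rewrite inE negbK.
have := dz i; rewrite /comb (bigD1 e) //= dE eqxx mul1r => /eqP.
rewrite addr_eq0 => /eqP ->; rewrite F2_oppr [RHS](bigID (fun t => t == e)) /=.
rewrite [X in _ = X + _]big1 ?add0r => [|t /andP[+ /eqP te]]; last by rewrite te ce eqxx.
rewrite [LHS](bigID (fun t => c t != 0)) /= [X in _ + X]big1 ?addr0.
  by apply: eq_big => [t|t /andP[te ct]]; rewrite 1?andbC // dE ct orbT mul1r.
by move=> t /andP[/negPf te /negPf ct]; rewrite dE te ct mul0r.
Qed.

Section TreeGraph.
Variables (X Q : {set T}) (r : V) (K : {set V}).
Variables (P : V -> {set T}) (y : V -> 'F_3) (k : T -> 'F_3) (cq : T -> 'F_3).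
Hypotheses (two : two_support v) (nt : normal_tree v X r K P y k).
Hypothesis (XM : X \subset ground M).
Hypothesis (XK : forall e x, e \in X -> v e x != 0 -> x \in K).
Hypothesis (QM : Q \subset ground M).
Hypothesis (Qsupp : forall t, (cq t != 0) = (t \in Q)).
Hypothesis (Qcomb : forall x, comb v cq x = (x == r)%:R).
Hypothesis (QK : forall t x, t \in Q -> x \in K -> x != r -> v t x = 0).
Hypothesis (Qindep : ~ dep v Q).

Let tree := \bigcup_(a in K) P a.
Let Z := tree :|: Q.

Lemma tree_notin x t : t \in tree -> x \notin K -> v t x = 0.
Proof. by case/bigcupP=> a aK ta; apply: (tree_in nt aK ta). Qed.

Lemma tree_disjoint t : t \in tree -> t \notin Q.
Proof.
move=> tt; apply/negP=> tQ.
have H := tree_indep nt (c := fun e => if e == t then 1 else 0).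
suff : (if t == t then 1 else 0 : 'F_3) = 0 by rewrite eqxx.
apply: H => [u uN|x xr]; first by case: eqP => // ut; rewrite ut tt in uN.
rewrite comb_delta mul1r; have [xK|xK] := boolP (x \in K); first exact: QK.
exact: tree_notin.
Qed.

(** On K the vectors of Q are nonzero only at r, and those of the tree vanish off K. As [tree_indep]
    ignores r, it kills the tree part of any relation, and the independence of Q kills the rest. *)
Lemma tree_union_indep : ~ dep v Z.
Proof.
move=> [c [sc [e ce] z]].
pose c1 t := if t \in tree then c t else 0.
have c10 : forall t, c1 t = 0.
  apply: (tree_indep nt) => [t tN|x xr]; first by rewrite /c1 (negPf tN).
  rewrite comb_restrict; have [xK|xK] := boolP (x \in K); last first.
    by rewrite big1 // => t tt; rewrite tree_notin ?mulr0.
  rewrite -[RHS](z x) /comb [RHS](bigID (mem tree)) /= [X in _ = _ + X]big1 ?addr0 // => t tN.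
  have [tQ|tQ] := boolP (t \in Q); first by rewrite QK ?mulr0.
  by rewrite sc ?mul0r // inE negb_or tN.
have ct t : t \in tree -> c t = 0 by move=> tt; have := c10 t; rewrite /c1 tt.
apply: Qindep; exists c; split=> //; last by exists e.
move=> t tQ; have [/ct//|tN] := boolP (t \in tree).
by apply: sc; rewrite inE negb_or tN.
Qed.

Lemma Z_ground : Z \subset ground M.
Proof.
rewrite subUset QM andbT; apply/bigcupsP=> a aK.
by apply/subsetP=> t /(tree_sub nt aK)/(subsetP XM).
Qed.

(** F_2 potentials chosen so that an edge vector is the sum of the potentials of its ends. The root
    has an empty path and so potential 0; the extra vertex [None] differs from it by the sum of
    Q. *)
Let pot (p : option V) (i : I) : 'F_2 :=
  if p is Some a then \sum_(t in P a) f t i else \sum_(t in Q) f t i.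

Let inK (p : option V) := if p is Some a then a \in K else true.

Lemma expand c lam e : e \in X -> lam != 0 ->
  supported Z c -> (forall x, comb v c x = lam * v e x) ->
  forall i, f e i = \sum_(t | c t != 0) f t i.
Proof.
by move=> eX; apply: binary_expansion Z_ground tree_union_indep (subsetP XM _ eX).
Qed.

Let kk a t := if t \in P a then k t else 0.

Lemma comb_kk a x : a \in K -> comb v (kk a) x = y a * (x == a)%:R - (x == r)%:R.
Proof. by move=> aK; rewrite comb_restrict (tree_sum nt). Qed.

Lemma kk_supported a t : a \in K -> t \notin Z -> kk a t = 0.
Proof.
move=> aK; rewrite inE negb_or => /andP[tN _]; rewrite /kk; case: ifPn => // ta.
by case/bigcupP: tN; exists a.
Qed.

Lemma in_tree a t : a \in K -> t \in P a -> t \in tree.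
Proof. by move=> aK ta; apply/bigcupP; exists a. Qed.

Lemma cq_supported t : t \notin Z -> cq t = 0.
Proof. by rewrite inE negb_or => /andP[_ tQ]; apply/eqP/negbFE; rewrite Qsupp (negPf tQ). Qed.

Lemma sum_PQ a i : a \in K ->
  \sum_(t | (t \in P a) || (t \in Q)) f t i = pot (Some a) i + pot None i.
Proof.
move=> aK; rewrite (bigID (mem (P a))) /=; congr (_ + _); apply: eq_bigl => t.
  by case: (t \in P a); rewrite ?andbF.
case tP : (t \in P a); rewrite ?andbT ?andbF //=.
by have := tree_disjoint (in_tree aK tP); case: (t \in Q).
Qed.

(* A link whose tree cycle is negative closes through Q, hence behaves as a link from its
   lower end a to the extra vertex None of the graph. *)
Lemma tree_link e a b : e \in X -> v e a != 0 -> v e b != 0 -> a != b ->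
  P b \subset P a ->
  (forall i, f e i = pot (Some a) i + pot (Some b) i) \/
  (forall i, f e i = pot (Some a) i + pot None i).
Proof.
move=> eX ea eb ab sP.
have aK := XK eX ea; have bK := XK eX eb.
have ya := tree_scale nt aK; have yb := tree_scale nt bK.
pose lam := y a / v e a; have lam0 : lam != 0 by rewrite mulf_neq0 ?invr_eq0.
have lama : lam * v e a = y a by rewrite divfK.
have vE x : lam * v e x = y a * (x == a)%:R + lam * v e b * (x == b)%:R.
  have [->|xa] := eqVneq x a; first by rewrite lama (negPf ab) mulr1 mulr0 addr0.
  have [->|xb] := eqVneq x b; first by rewrite mulr1 mulr0 add0r.
  rewrite !mulr0 addr0; apply/eqP; rewrite mulf_eq0 (negPf lam0) /=.
  apply/negPn/negP=> ex; case: (two ea eb ex ab) => E1; [case/eqP: xa | case/eqP: xb] => //.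
have lb : lam * v e b != 0 by rewrite mulf_neq0.
have kN t : t \in P a -> k t != 0 by apply: (tree_coef nt aK).
(* Scaled to [y a] at a, the edge has entry [y b] or [- y b] at b. In the first case the two path
   sums add up with an excess of -2 at r, which 2 times Q repairs, and the common part [P b] keeps
   the nonzero coefficients 2k. In the second case they are subtracted and [P b] cancels. *)
case: (F3_eqN lb yb) => u.
  right=> i.
  rewrite (expand (c := fun t => (kk a t + 1 * kk b t) + 2%:R * cq t) eX lam0); first last.
  - move=> x; rewrite !combD !comb_kk // Qcomb vE u mul1r.
    by rewrite mulr_natl mulr2n addrACA !subrK.
  - by move=> t tZ; rewrite !kk_supported // cq_supported // !mulr0 !addr0.
  rewrite -sum_PQ //; apply: eq_bigl => t; rewrite /kk mul1r.
  case tP : (t \in P a) => /=.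
    have /negPf tQ := tree_disjoint (in_tree aK tP).
    have -> : cq t = 0 by apply/eqP/negbFE; rewrite Qsupp.
    rewrite mulr0 addr0; case: ifP => _; last by rewrite addr0 kN.
    by rewrite -mulr2n -mulr_natl mulf_neq0 ?kN.
  have /negPf -> : t \notin P b by apply: contraFN tP; apply: subsetP.
  by rewrite !add0r mulf_eq0 negb_or Qsupp.
left=> i; rewrite (expand (c := fun t => kk a t - 1 * kk b t) eX lam0); first last.
- move=> x; rewrite combB !comb_kk // vE u mul1r mulNr opprB.
  by rewrite addrA subrK.
- by move=> t tZ; rewrite !kk_supported // mulr0 subr0.
rewrite /pot [\sum_(t in P a) _](bigID (mem (P b))) /=.
rewrite [X in X + _ + _](_ : _ = \sum_(t in P b) f t i).
  rewrite addrAC F2_addrr add0r; apply: eq_bigl => t; rewrite /kk mul1r.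
  case tP : (t \in P a) => /=.
    by case: (t \in P b); rewrite ?subrr ?eqxx // subr0 kN.
  have /negPf -> : t \notin P b by apply: contraFN tP; apply: subsetP.
  by rewrite subrr eqxx.
by apply: eq_bigl => t; rewrite andbC; case tP : (t \in P b) => //=; apply: (subsetP sP).
Qed.

(** Besides links, a vector with a single nonzero entry, as of a half-edge or a negative loop,
    becomes a link to [None], and the zero vector becomes a loop at [None]. *)
Lemma tree_edge_ends e : e \in X ->
  exists pq : option V * option V, [/\ inK pq.1, inK pq.2 &
    forall i, f e i = pot pq.1 i + pot pq.2 i].
Proof.
move=> eX.
have [[a [b [ab ea eb]]]|no2] := classic (exists a b, [/\ a != b, v e a != 0 & v e b != 0]).
  have half a' b' : a' != b' -> v e a' != 0 -> v e b' != 0 -> P b' \subset P a' ->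
      exists pq : option V * option V, [/\ inK pq.1, inK pq.2 &
        forall i, f e i = pot pq.1 i + pot pq.2 i].
    move=> ab' ea' eb' sP; have [H|H] := tree_link eX ea' eb' ab' sP.
      by exists (Some a', Some b'); rewrite /= (XK eX ea') (XK eX eb').
    by exists (Some a', None); rewrite /= (XK eX ea').
  have [sP|sP] := tree_normal nt eX (XK eX ea) (XK eX eb) ea eb; last exact: (half a b).
  by apply: (half b a); rewrite // eq_sym.
have [[a ea]|no1] := classic (exists a, v e a != 0).
  have aK := XK eX ea; have ya := tree_scale nt aK.
  pose lam := y a / v e a; have lam0 : lam != 0 by rewrite mulf_neq0 ?invr_eq0.
  exists (Some a, None); split=> // i.
  rewrite (expand (c := fun t => kk a t + 1 * cq t) eX lam0); first last.
  - move=> x; rewrite combD comb_kk // Qcomb mul1r subrK.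
    have [->|xa] := eqVneq x a; first by rewrite mulr1 divfK.
    rewrite mulr0; apply/esym/eqP; rewrite mulf_eq0 (negPf lam0) /=.
    by apply/negPn/negP=> ex; apply: no2; exists x, a.
  - by move=> t tZ; rewrite kk_supported // cq_supported // mulr0 addr0.
  rewrite -sum_PQ //; apply: eq_bigl => t; rewrite /kk mul1r.
  case tP : (t \in P a) => /=; last by rewrite add0r Qsupp.
  have /negPf tQ := tree_disjoint (in_tree aK tP).
  have -> : cq t = 0 by apply/eqP/negbFE; rewrite Qsupp.
  by rewrite addr0 (tree_coef nt aK tP).
exists (None, None); split=> // i; rewrite F2_addrr.
rewrite (expand (c := fun=> 0) (lam := 1) eX) ?oner_eq0 //.
  by apply: big1 => t; rewrite eqxx.
move=> x; rewrite /comb big1 => [|t _]; last by rewrite mul0r.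
by rewrite mul1r; apply/esym/eqP/negPn/negP=> ex; apply: no1; exists x.
Qed.

(** Potentials are sums over subsets of the independent set [Z], so every element of [Z] has total
    coefficient 0. An element of Q isolates [None]. Among the remaining vertices with nonzero
    coefficient take a with the largest path: the element that [tree_edge] gives for a lies only in
    paths containing [P a], hence in no other path that counts. *)
Lemma potential_indep (d : option V -> 'F_2) :
  (forall a, a \notin K -> d (Some a) = 0) ->
  (forall i, \sum_p d p * pot p i = 0) -> forall p, p != Some r -> d p = 0.
Proof.
move=> dK dz.
have sum_option (g : option V -> 'F_2) : \sum_p g p = g None + \sum_a g (Some a).
  rewrite (bigD1 None) //=; congr (_ + _).
  rewrite (reindex_omap Some id) => [|[a|]] //=.
  by apply: eq_bigl => a; rewrite eqxx.
pose c t := d None * (t \in Q)%:R + \sum_a d (Some a) * (t \in P a)%:R.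
have c0 : forall t, c t = 0.
  have nZ : ~ dep f Z by move/(dep_transfer Z_ground)/tree_union_indep.
  move=> t; apply: NNPP => ct; apply: nZ; exists c; split; last 1 first.
  - move=> i; rewrite -[RHS](dz i) sum_option /comb.
    under eq_bigr => u _ do rewrite mulrDl mulr_suml.
    rewrite big_split /= exchange_big /=; congr (_ + _).
      rewrite mulr_sumr [RHS]big_mkcond; apply: eq_bigr => u _.
      by case: (u \in Q); rewrite ?mulr1 ?mulr0 ?mul0r.
    apply: eq_bigr => a _; rewrite mulr_sumr [RHS]big_mkcond; apply: eq_bigr => u _.
    by case: (u \in P a); rewrite ?mulr1 ?mulr0 ?mul0r.
  - move=> u; rewrite inE negb_or => /andP[uT uQ]; rewrite /c (negPf uQ) mulr0 add0r.
    rewrite big1 // => a _; have [aK|/dK ->] := boolP (a \in K); last by rewrite mul0r.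
    have [ua|_] := boolP (u \in P a); last by rewrite mulr0.
    by rewrite (in_tree aK ua) in uT.
  by exists t; apply/eqP.
have [q qQ] : exists q, q \in Q.
  apply: NNPP => no; have := Qcomb r; rewrite eqxx /comb big1 => [/eqP|t _].
    by rewrite eq_sym oner_eq0.
  have -> : cq t = 0; last by rewrite mul0r.
  by apply/eqP/negbFE; rewrite Qsupp; apply/negP=> tQ; apply: no; exists t.
have dNone : d None = 0.
  have := c0 q; rewrite /c qQ mulr1 big1 ?addr0 // => a _.
  have [aK|/dK ->] := boolP (a \in K); last by rewrite mul0r.
  case qa : (q \in P a); rewrite ?mulr0 //.
  by have := tree_disjoint (in_tree aK qa); rewrite qQ.
case=> [a|//] ar; have {}ar : a != r by apply: contraNneq ar => ->.
apply/eqP/negPn/negP=> da.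
pose R b := (b != r) && (d (Some b) != 0).
have Ra : R a by rewrite /R ar.
case: (@arg_maxnP _ a R (fun b => #|P b|) Ra) => {ar da Ra} {}a /andP[ar da] maxa.
have aK : a \in K by apply: contraNT da => /dK ->.
have [t ta tP] := tree_edge nt aK ar.
have := c0 t; rewrite /c dNone mul0r add0r (bigD1 a) //= ta mulr1 big1 ?addr0.
  by move=> da0; rewrite da0 in da.
move=> b ba; have [->|db] := eqVneq (d (Some b)) 0; first by rewrite mul0r.
have bK : b \in K by apply: contraNT db => /dK ->.
case tb : (t \in P b); rewrite ?mulr0 //.
have br : b != r by apply: contraTneq tb => ->; have [_ [-> _]] := tree_root nt; rewrite inE.
have sub := tP b bK tb.
have EP : P a = P b.
  by apply/eqP; rewrite eqEcard sub; apply: maxa; rewrite /R br.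
have := tree_sum nt b bK; rewrite -EP (tree_sum nt b aK) eqxx (negPf ba) mulr0 mulr1.
by move/(congr1 (fun z => z + (b == r)%:R)); rewrite !subrK => /esym/eqP;
  rewrite (negPf (tree_scale nt bK)).
Qed.

Lemma tree_graphic : graphic_on M X.
Proof.
have : exists a : T -> option V * option V, forall e, e \in X -> [/\ inK (a e).1, inK (a e).2 &
    forall i, f e i = pot (a e).1 i + pot (a e).2 i].
  apply: (@fin_all_exists _ _ (fun e pq => e \in X -> [/\ inK pq.1, inK pq.2 &
    forall i, f e i = pot pq.1 i + pot pq.2 i])) => e.
  have [/tree_edge_ends[pq H]|eX] := boolP (e \in X); first by exists pq.
  by exists (None, None).
case=> a aP; apply: (graphic_on_incidence (F := 'F_2) (a := a)) => X' sX'.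
rewrite (rf (subset_trans sX' XM)).
set g := fun e x => _.
have deltaE p i : \sum_x (x == p)%:R * pot x i = pot p i.
  by rewrite (bigD1 p) //= eqxx mul1r big1 ?addr0 // => x /negPf ->; rewrite mul0r.
have fE e i : e \in X -> f e i = \sum_x g e x * pot x i.
  move=> /aP[_ _ ->]; rewrite /g.
  under eq_bigr do rewrite F2_oppr mulrDl; rewrite big_split /=.
  by rewrite !deltaE.
have combE c i : supported X' c -> comb f c i = \sum_x comb g c x * pot x i.
  move=> sc; rewrite (comb_in _ _ sc).
  under eq_bigr => e eX' do rewrite (fE _ _ (subsetP sX' e eX')) mulr_sumr.
  rewrite exchange_big; apply: eq_bigr => x _ /=; rewrite (comb_in _ _ sc) mulr_suml.
  by apply: eq_bigr => e _; rewrite mulrA.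
split=> [[c [sc nz z]]|[c [sc nz z]]]; exists c; split=> //; last first.
  by move=> i; rewrite combE // big1 // => x _; rewrite z mul0r.
move=> p.
have d0 : forall p, p != Some r -> comb g c p = 0.
  apply: potential_indep => [b bK|i]; last by rewrite -combE.
  rewrite (comb_in _ _ sc) big1 // => e /(subsetP sX')/aP[]; rewrite /g.
  case: (a e) => -[p1|] [p2|] //= k1 k2 _.
  - rewrite !(inj_eq Some_inj); case: eqP => [E1|_]; first by rewrite E1 k1 in bK.
    by case: eqP => [E1|_]; [rewrite E1 k2 in bK | rewrite subrr mulr0].
  - rewrite (inj_eq Some_inj); case: eqP => [E1|_]; first by rewrite E1 k1 in bK.
    by rewrite subrr mulr0.
  - rewrite (inj_eq Some_inj); case: eqP => [E1|_]; first by rewrite E1 k2 in bK.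
    by rewrite subrr mulr0.
  by rewrite subrr mulr0.
have [->|] := eqVneq p (Some r); last exact: d0.
(* The root has potential 0, so its coordinate is invisible in f. It is recovered from the others
   because the entries of each graph edge sum to 0. *)
have : \sum_x comb g c x = 0.
  rewrite /comb exchange_big big1 // => e _ /=; rewrite -mulr_sumr sumrB.
  rewrite (bigD1 (a e).1) //= eqxx big1 => [|x /negPf -> //].
  rewrite (bigD1 (a e).2) //= eqxx big1 => [|x /negPf -> //].
  by rewrite subrr mulr0.
by rewrite (bigD1 (Some r)) //= big1 ?addr0 // => x xr; apply: d0.
Qed.

End TreeGraph.
End FundamentalCircuits.

(** * Non-graphic restrictions and their complements *)

Lemma prop_set (T : finType) (P : T -> Prop) : exists A : {set T}, forall x, x \in A <-> P x.
Proof.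
have [b bP] : exists b : T -> bool, forall x, b x <-> P x.
  apply: (@fin_all_exists _ _ (fun x b => is_true b <-> P x)) => x.
  by case: (classic (P x)) => Px; [exists true | exists false].
by exists [set x | b x] => x; rewrite inE.
Qed.

(** As long as the vectors in use are dependent, subtracting a multiple of a relation removes one of
    them. *)
Lemma minimal_expansion (F : fieldType) (T I : finType) (v : T -> I -> F) (X : {set T}) w :
  inspan v X w -> exists c, [/\ supported X c, forall x, comb v c x = w x &
    ~ dep v [set t | c t != 0]].
Proof.
move=> [c [sc cw]].
have [n lt] := ubnP #|[set t | c t != 0]|; elim: n c sc cw lt => // n IH c sc cw lt.
have [[c' [sc' [t ct'] z']]|nd] := classic (dep v [set t | c t != 0]); last by exists c.
have sub u : c u = 0 -> c' u = 0 by move=> cu; apply: sc'; rewrite inE cu eqxx.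
have ct : c t != 0 by apply: contra_neq ct'; apply: sub.
apply: (IH (fun u => c u - (c t / c' t) * c' u)) => [u uX|x|].
- by rewrite (sc u uX) (sub u (sc u uX)) mulr0 subr0.
- by rewrite combB cw z' mulr0 subr0.
rewrite ltnS in lt; apply: leq_trans lt; apply: proper_card; apply/properP; split.
  by apply/subsetP=> u; rewrite !inE; apply: contra_neq => cu; rewrite cu (sub u) // mulr0 subr0.
by exists t; rewrite inE // divfK // subrr eqxx.
Qed.

(** * Vectors with at most two nonzero entries *)

Section TwoSupport.
Variables (F : fieldType) (T V : finType) (v : T -> V -> F).
Hypothesis two : two_support v.

Lemma two_supportE e x z : x != z -> v e x != 0 -> v e z != 0 ->
  forall u, v e u = v e x * (u == x)%:R + v e z * (u == z)%:R.
Proof.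
move=> xz ex ez u.
have [->|ux] := eqVneq u x; first by rewrite (negPf xz) mulr1 mulr0 addr0.
have [->|uz] := eqVneq u z; first by rewrite mulr1 mulr0 add0r.
rewrite !mulr0 addr0; apply/eqP/negPn/negP=> eu.
by case: (two ex ez eu xz) => E1; [case/eqP: ux | case/eqP: uz].
Qed.

Lemma sum_delta (phi : V -> F) (k : F) x : \sum_u phi u * (k * (u == x)%:R) = phi x * k.
Proof.
rewrite (bigD1 x) //= eqxx mulr1 big1 ?addr0 // => u /negPf ->.
by rewrite !mulr0.
Qed.

Lemma pairing_two phi e x z : x != z -> v e x != 0 -> v e z != 0 ->
  pairing v phi e = phi x * v e x + phi z * v e z.
Proof.
move=> xz ex ez; rewrite /pairing.
under eq_bigr => u _ do rewrite (two_supportE xz ex ez u) mulrDr.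
by rewrite big_split /= !sum_delta.
Qed.

Lemma pairing_ends phi e x z : pairing v phi e = 0 -> v e x != 0 -> v e z != 0 ->
  phi x = 0 -> phi z = 0.
Proof.
move=> p0 ex ez px; have [<-//|xz] := eqVneq x z.
move: p0; rewrite (pairing_two _ xz ex ez) px mul0r add0r => /eqP.
by rewrite mulf_eq0 (negPf ez) orbF => /eqP.
Qed.

Lemma inspan_other_end X e x z : v e x != 0 -> v e z != 0 -> x != z ->
  inspan v X (v e) -> inspan v X (fun u => (u == x)%:R) -> inspan v X (fun u => (u == z)%:R).
Proof.
move=> ex ez xz [c [sc cz]] [c' [sc' cz']].
exists (fun t => (v e z)^-1 * c t - (v e x / v e z) * c' t); split=> [t tX|u].
  by rewrite sc // sc' // !mulr0 subrr.
rewrite combB cz'; have -> : comb v (fun t => (v e z)^-1 * c t) u = (v e z)^-1 * v e u.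
  by rewrite combZ cz.
rewrite (two_supportE xz ex ez u) mulrDr mulKf // mulrA [_^-1 * _]mulrC.
by rewrite addrAC subrr add0r.
Qed.

(** When no vector of X has nonzero entries both in W and off it, the vectors meeting W and the
    others have disjoint supports. Combined with [undecomposable], this is how connectedness is
    exploited. *)
Lemma isolated_direct (W : {set V}) (X : {set T}) :
  (forall e x z, e \in X -> x \in W -> z \notin W -> v e x != 0 -> v e z = 0) ->
  exists A B, [/\ A :|: B = X, [disjoint A & B], direct v A B,
    forall e x, e \in X -> x \in W -> v e x != 0 -> e \in A &
    forall e, e \in A -> exists2 x, x \in W & v e x != 0].
Proof.
move=> iso; pose A := [set e in X | [exists x in W, v e x != 0]].
have AX : A \subset X by apply/subsetP=> e; rewrite inE => /andP[].
have dAB : [disjoint A & X :\: A] by rewrite disjoints_subset setCD subsetUr.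
exists A, (X :\: A); split=> //.
- by rewrite -[RHS](setID _ A) (setIidPr AX).
- apply: (direct_support (W := W)) => // e x.
    rewrite inE => /andP[eX /existsP[z /andP[zW ez]]] xW; exact: iso ez.
  rewrite !inE => /andP[+ eX] xW; rewrite eX /= => /existsPn/(_ x).
  by rewrite xW /= negbK => /eqP.
- by move=> e x eX xW ex; rewrite inE eX; apply/existsP; exists x; rewrite xW.
by move=> e; rewrite inE => /andP[_ /existsP[x /andP[xW ex]]]; exists x.
Qed.

End TwoSupport.

(** * The vertices of a non-graphic set and the edges off them *)

Section Main.
Variables (T V : finType) (v : T -> V -> 'F_3) (M : matroid T).
Hypotheses (two : two_support v) (rv : represents v M).
Implicit Types (X Y A B : {set T}).

Lemma minimal_nongraphic X : ~ graphic_on M X ->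
  exists Z : {set T}, [/\ Z \subset X, ~ graphic_on M Z &
    forall Z' : {set T}, Z' \proper Z -> graphic_on M Z'].
Proof.
have [n lt] := ubnP #|X|; elim: n X lt => // n IH X lt ngX.
have [[Z [pZ ngZ]]|no] := classic (exists Z : {set T}, Z \proper X /\ ~ graphic_on M Z).
  have [|Z' [sZ' ngZ' minZ']] := IH Z _ ngZ.
    by apply: leq_trans (proper_card pZ) _; rewrite -ltnS.
  by exists Z'; split=> //; apply: subset_trans sZ' (proper_sub pZ).
by exists X; split=> // Z pZ; apply: NNPP => ngZ; apply: no; exists Z.
Qed.

Lemma minimal_nongraphic_undecomposable X : X \subset ground M -> ~ graphic_on M X ->
  (forall Z : {set T}, Z \proper X -> graphic_on M Z) -> undecomposable v X.
Proof.
move=> sX ng minX A B EX dAB dir; apply: NNPP => /not_or_and[/eqP nA /eqP nB].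
case: ng; rewrite -EX; apply: (graphic_on_direct rv) => //; first by rewrite EX.
  apply: minX; rewrite -EX; apply/properP; split; first exact: subsetUl.
  by have /set0Pn[b bB] := nB; exists b; rewrite ?inE ?bB ?orbT // (disjointFl dAB bB).
apply: minX; rewrite -EX; apply/properP; split; first exact: subsetUr.
by have /set0Pn[b bA] := nA; exists b; rewrite ?inE ?bA ?orbT // (disjointFr dAB bA).
Qed.

Definition ends X := [set x | [exists e in X, v e x != 0]].

Lemma endsP X x : reflect (exists2 e, e \in X & v e x != 0) (x \in ends X).
Proof.
rewrite inE; apply: (iffP existsP) => [[e /andP[eX ex]]|[e eX ex]]; exists e => //.
exact/andP.
Qed.

(* A functional vanishing on X but not on all its ends is a switching function which
   makes every edge of X positive, so that X is graphic. *)
Lemma balanced_graphic X phi : X \subset ground M ->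
  (forall e, e \in X -> pairing v phi e = 0) ->
  (forall e, e \in X -> exists2 x, phi x != 0 & v e x != 0) -> graphic_on M X.
Proof.
move=> sX phi0 touch.
have [->|[e0 e0X]] := set_0Vmem X; first exact: graphic_on0.
have [x0 _ _] := touch e0 e0X.
have nzE e x : e \in X -> v e x != 0 -> phi x != 0.
  move=> eX ex; have [z pz ez] := touch e eX.
  by apply: contra_neq pz; apply: (pairing_ends two (phi0 e eX) ex ez).
(* Multiplying each coordinate by phi is the switching: the two entries of an edge become opposite,
   because the pairing, which is their sum, vanishes. *)
have [g gP] : exists g : T -> (V * V) * 'F_3, forall e, e \in X -> (g e).2 != 0 /\
    forall x, phi x * v e x = (g e).2 * ((x == (g e).1.1)%:R - (x == (g e).1.2)%:R).
  apply: (@fin_all_exists _ _ (fun e h => e \in X -> h.2 != 0 /\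
    forall x, phi x * v e x = h.2 * ((x == h.1.1)%:R - (x == h.1.2)%:R))) => e.
  have [eX|eX] := boolP (e \in X); last by exists ((x0, x0), 0).
  have [x px ex] := touch e eX.
  have [z zx ez] : exists2 z, z != x & v e z != 0.
    apply: NNPP => no; have := phi0 e eX; rewrite /pairing (bigD1 x) //= big1.
      by rewrite addr0 => /eqP; rewrite mulf_eq0 (negPf px) (negPf ex).
    move=> z zx; have [->|ez] := eqVneq (v e z) 0; first by rewrite mulr0.
    by case: no; exists z.
  exists ((x, z), phi x * v e x) => _; split=> [|u] /=; first by rewrite mulf_neq0.
  have := phi0 e eX; rewrite eq_sym in zx; rewrite (pairing_two two _ zx ex ez) => E0.
  have [->|ux] := eqVneq u x; first by rewrite (negPf zx) subr0 mulr1.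
  have [->|uz] := eqVneq u z.
    by rewrite sub0r mulrN1; apply/eqP; rewrite -addr_eq0 addrC E0.
  rewrite subrr mulr0 (two_supportE two zx ex ez) (negPf ux) (negPf uz).
  by rewrite !mulr0 addr0 mulr0.
apply: (graphic_on_incidence (F := 'F_3) (a := fun e => (g e).1)) => X' sX'.
rewrite (rv (subset_trans sX' sX)).
set G := fun e x => _.
have conv (c : T -> 'F_3) x : supported X' c ->
    comb G (fun e => c e * (g e).2) x = phi x * comb v c x.
  move=> sc; rewrite /comb mulr_sumr; apply: eq_bigr => e _.
  have [eX'|/sc ->] := boolP (e \in X'); last by rewrite !mul0r mulr0.
  by have [_ gE] := gP e (subsetP sX' e eX'); rewrite mulrCA gE -mulrA.
split=> [[c [sc [e ce] z]]|[c [sc [e ce] z]]].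
  have eX : e \in X by apply: (subsetP sX'); apply: contraR ce => /sc ->.
  exists (fun e => c e * (g e).2); split=> [t /sc -> | | x]; first by rewrite mul0r.
    by exists e; rewrite mulf_neq0 //; case: (gP e eX).
  by rewrite conv // z mulr0.
have eX : e \in X by apply: (subsetP sX'); apply: contraR ce => /sc ->.
have sc' : supported X' (fun e => c e / (g e).2) by move=> t /sc ->; rewrite mul0r.
exists (fun e => c e / (g e).2); split=> // [|x].
  by exists e; rewrite mulf_neq0 // invr_eq0; case: (gP e eX).
have := conv _ x sc'; have -> : comb G (fun e => c e / (g e).2 * (g e).2) x = 0.
  rewrite -[RHS](z x) !(comb_in _ _ sc) /comb.
  rewrite [LHS](bigID (mem X')) /= [X in _ + X]big1 ?addr0 => [|t /sc ->]; last by rewrite !mul0r.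
  by apply: eq_bigr => t tX; rewrite divfK //; case: (gP t (subsetP sX' t tX)).
have [px _|px /esym/eqP] := eqVneq (phi x) 0; last first.
  by rewrite mulf_eq0 (negPf px) => /eqP.
rewrite (comb_in _ _ sc') big1 // => t tX.
have [->|tx] := eqVneq (v t x) 0; first by rewrite mulr0.
by have := nzE t x (subsetP sX' t tX) tx; rewrite px eqxx.
Qed.

(** A functional that vanishes on X but not at x has a support closed under the edges of X.
    Connectedness then makes it nonzero at an end of every edge, as [balanced_graphic] demands. *)
Lemma ends_inspan X : X \subset ground M -> undecomposable v X -> ~ graphic_on M X ->
  forall x, x \in ends X -> inspan v X (fun u => (u == x)%:R).
Proof.
move=> sX und ng x /endsP[e eX ex]; apply: NNPP => /not_inspan[phi [phi0]].
have -> : \sum_u phi u * (u == x)%:R = phi x.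
  by rewrite -[RHS]mulr1 -(sum_delta phi 1 x); apply: eq_bigr => u _; rewrite mul1r.
move=> px; apply: ng.
have [|A [B [EX dAB dir inA Aends]]] := @isolated_direct _ _ _ v [set u | phi u != 0] X.
  move=> t u w tX; rewrite !inE negbK => pu /eqP pw tu.
  apply/eqP/negPn/negP=> tw; case/eqP: pu; exact: (pairing_ends two (phi0 t tX) tw tu).
have eA : e \in A by apply: (inA e x) => //; rewrite inE.
case: (und A B EX dAB dir) => [A0|B0]; first by rewrite A0 inE in eA.
apply: (balanced_graphic sX phi0) => t; rewrite -EX B0 setU0 => /Aends[u].
by rewrite inE; exists u.
Qed.

Lemma functional_ends X phi : X \subset ground M -> undecomposable v X -> ~ graphic_on M X ->
  (forall t, t \in X -> pairing v phi t = 0) -> forall x, x \in ends X -> phi x = 0.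
Proof.
move=> sX und ng phi0 x /(ends_inspan sX und ng)/inspan_pairing/(_ phi0) <-.
rewrite (eq_bigr (fun u => phi u * (1 * (u == x)%:R))) ?sum_delta ?mulr1 // => u _.
by rewrite mul1r.
Qed.

Lemma ends_supported_inspan X w : X \subset ground M -> undecomposable v X ->
  ~ graphic_on M X -> (forall x, x \notin ends X -> w x = 0) -> inspan v X w.
Proof.
move=> sX und ng w0; apply: NNPP => /not_inspan[phi [phi0 /eqP[]]].
apply: big1 => x _; have [xX|/w0 ->] := boolP (x \in ends X); last by rewrite mulr0.
by rewrite (functional_ends sX und ng phi0) ?mul0r.
Qed.

Lemma spanning_tree X r : undecomposable v X -> r \in ends X ->
  exists P y k, normal_tree v X r (ends X) P y k.
Proof.
move=> und rX; apply: normal_tree_exists => //.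
  by move=> e x eX ex; apply/endsP; exists e.
move=> U sU rU UK; apply: NNPP => no.
have [|A [B [EX dAB dir inA Aends]]] := @isolated_direct _ _ _ v U X.
  move=> e x z eX xU zU ex; apply/eqP/negPn/negP=> ez; apply: no.
  by exists e, x, z.
have [e eX er] := endsP _ _ rX; have eA := inA e r eX rU er.
have [z zX zU] : exists2 z, z \in ends X & z \notin U.
  by apply/subsetPn; apply: contra UK => s; rewrite eqEsubset sU.
have [t tX tz] := endsP _ _ zX.
case: (und A B EX dAB dir) => [A0|B0]; first by rewrite A0 inE in eA.
have : t \in A by move: tX; rewrite -EX B0 setU0.
by case/Aends=> x xU tx; apply: no; exists t, x, z.
Qed.

Variables (I : finType) (f : T -> I -> 'F_2).
Hypothesis rf : represents f M.
Hypothesis M_und : undecomposable v (ground M).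

Section NongraphicPart.
Variable X : {set T}.
Hypotheses (XM : X \subset ground M) (X_und : undecomposable v X) (X_ng : ~ graphic_on M X).

Definition outside := [set e in ground M | [forall x in ends X, v e x == 0]].

Lemma outsideP e x : e \in outside -> x \in ends X -> v e x = 0.
Proof. by rewrite inE => /andP[_ /forallP/(_ x)/implyP h] /h/eqP. Qed.

Lemma not_outside e : e \in ground M -> e \notin outside -> exists2 x, x \in ends X & v e x != 0.
Proof.
by move=> eM; rewrite inE eM /= => /forallPn[x]; rewrite negb_imply => /andP[xX ex]; exists x.
Qed.

Lemma nongraphic_neq0 : exists e, e \in X.
Proof.
by apply/set0Pn/negP=> /eqP X0; apply: X_ng; rewrite X0; apply: graphic_on0.
Qed.

(** An edge off X carries membership in the span from one of its ends to the other. If no edge led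
    from the vertices thus reached to the ends of X, they would split M. *)
Lemma outside_attachment d : d \notin ends X -> inspan v outside (fun u => (u == d)%:R) ->
  exists e a b, [/\ e \in ground M, a \notin ends X, inspan v outside (fun u => (u == a)%:R),
    b \in ends X & (v e a != 0) && (v e b != 0)].
Proof.
move=> dX sd; apply: NNPP => no.
have [U UP] := prop_set (fun u => u \notin ends X /\ inspan v outside (fun z => (z == u)%:R)).
have [|A [B [EM dAB dir inA Aends]]] := @isolated_direct _ _ _ v U (ground M).
  move=> e x z eM /UP[xX sx] zU ex; apply/eqP/negPn/negP=> ez.
  have eO : e \in outside.
    apply: NNPP => /negP /(not_outside eM)[b bX eb]; apply: no.
    by exists e, x, b; rewrite ex eb.
  have xz : x != z by apply: contraNneq zU => <-; apply/UP.
  case/negP: zU; apply/UP; split.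
    by apply: contraNN ez => zX; rewrite (outsideP eO zX).
  by apply: (inspan_other_end two ex ez xz _ sx); apply: inspan_gen.
have dU : d \in U by apply/UP.
have [A0|B0] := M_und EM dAB dir.
  case: sd => c [sc cz]; have /eqP[] := oner_neq0 'F_3.
  have <- : comb v c d = 1 by rewrite cz eqxx.
  rewrite (comb_in _ _ sc) big1 // => e eO.
  have [->|ed] := eqVneq (v e d) 0; first by rewrite mulr0.
  have eM : e \in ground M by move: eO; rewrite inE => /andP[].
  by have := inA e d eM dU ed; rewrite A0 inE.
have [e eX] := nongraphic_neq0.
have : e \in A by have := subsetP XM e eX; rewrite -EM B0 setU0.
case/Aends=> u /UP[uX _] eu; case/negP: uX; apply/endsP; by exists e.
Qed.

(* Otherwise the part outside X is unbalanced and linked to a vertex b of X, so that in the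
   binary matroid b behaves as if it carried a half-edge; a depth-first search tree of X
   rooted at b then gives a graph representing X. *)
Lemma outside_balanced d : d \notin ends X -> exists psi : V -> 'F_3,
  [/\ forall x, x \in ends X -> psi x = 0, forall e, e \in outside -> pairing v psi e = 0
    & psi d != 0].
Proof.
move=> dX; apply: NNPP => no.
have sd : inspan v outside (fun u => (u == d)%:R).
  apply: NNPP => /not_inspan[phi [phi0 phid]]; apply: no.
  exists (fun x => if x \in ends X then 0 else phi x); split.
  - by move=> x ->.
  - move=> e eO; rewrite -[RHS](phi0 e eO); apply: eq_bigr => x _.
    by case: ifP => // xX; rewrite (outsideP eO xX) !mulr0.
  rewrite (negPf dX); apply: contra_neq phid => phid.
  by rewrite (eq_bigr (fun u => phi u * (1 * (u == d)%:R))) ?sum_delta ?phid ?mul0r // => u _;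
    rewrite mul1r.
have [e [a [b [eM aX sa bX /andP[ea eb]]]]] := outside_attachment dX sd.
have ab : a != b by apply: contraNneq aX => ->.
(* The vector of b is that of e corrected by a multiple of the vector of a; this makes b the root
   and gives Q inside [e |: outside]. *)
have sb : inspan v (e |: outside) (fun u => (u == b)%:R).
  apply: (inspan_other_end two ea eb ab); first exact: inspan_gen (setU11 _ _).
  exact: inspan_mono (subsetUr _ _) sa.
have [cq [scq cqE Qnd]] := minimal_expansion sb.
have [P [y [k nt]]] := spanning_tree X_und bX.
pose Q := [set t | cq t != 0].
have sQ : Q \subset e |: outside.
  by apply/subsetP=> t; rewrite inE; apply: contraR => /scq ->.
apply: X_ng; apply: (tree_graphic rv rf two nt XM (Q := Q) (cq := cq)) => //.
- by move=> t x tX tx; apply/endsP; exists t.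
- apply: subset_trans sQ _; rewrite subUset sub1set eM /=.
  by apply/subsetP=> t; rewrite inE => /andP[].
- by move=> t; rewrite inE.
move=> t x /(subsetP sQ); rewrite in_setU1 => /orP[/eqP ->|tO] xX xb; last first.
  exact: outsideP xX.
apply/eqP/negPn/negP=> ex; case: (two ea eb ex ab) => E1; last by rewrite E1 eqxx in xb.
by rewrite -E1 xX in aX.
Qed.

Hypothesis hns : forall Y, cocircuit M Y -> ~ graphic_on M (ground M :\: Y) ->
  undecomposable v (ground M :\: Y).

(* A minimal functional as in outside_balanced is a switching function of a component W of the
   part outside X; the edges joining W to X form a non-graphic cocircuit separating X from W. *)
Lemma outside_zero e : e \in outside -> forall x, v e x = 0.
Proof.
move=> eO a; apply/eqP/negPn/negP=> ea.
have eM : e \in ground M by move: eO; rewrite inE => /andP[].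
have aX : a \notin ends X by apply: contraNN ea => aX; rewrite (outsideP eO aX).
have [psi [psiX psiO psia]] := outside_balanced aX.
(* [R] singles out the functionals of the kind supplied by [outside_balanced]; over a finite type
   one of smallest support can be chosen. *)
pose R (g : {ffun V -> 'F_3}) := [&& [forall x in ends X, g x == 0],
  [forall t in outside, pairing v g t == 0] & g a != 0].
have RP (g : {ffun V -> 'F_3}) : R g <-> [/\ forall x, x \in ends X -> g x = 0,
    forall t, t \in outside -> pairing v g t = 0 & g a != 0].
  split=> [/and3P[/forallP h1 /forallP h2 h3]|[h1 h2 h3]].
    split=> // [x xX|t tO]; apply/eqP; [exact: implyP (h1 x) xX|exact: implyP (h2 t) tO].
  apply/and3P; split=> //; apply/forallP=> x; apply/implyP=> xX; apply/eqP; auto.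
have R0 : R [ffun x => psi x].
  apply/RP; split=> [x xX|t tO|]; last by rewrite ffunE.
    by rewrite ffunE psiX.
  by rewrite -[RHS](psiO t tO); apply: eq_bigr => x _; rewrite ffunE.
case: (@arg_minnP _ _ R (fun g : {ffun V -> 'F_3} => #|[set x | g x != 0]|) R0).
move=> phi /RP[phiX phiO phia] minphi.
have vanish := functional_ends XM X_und X_ng.
have phiX0 t : t \in X -> pairing v phi t = 0.
  move=> tX; rewrite /pairing big1 // => x _; have [->|tx] := eqVneq (v t x) 0.
    by rewrite mulr0.
  by rewrite phiX ?mul0r //; apply/endsP; exists t.
pose Y := [set t in ground M | pairing v phi t != 0].
have isoW (Z : {set T}) : (forall t, t \in Z -> pairing v phi t = 0) ->
    exists A B, [/\ A :|: B = Z, [disjoint A & B], direct v A B,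
      forall t x, t \in Z -> x \in [set x | phi x != 0] -> v t x != 0 -> t \in A &
      forall t, t \in A -> exists2 x, x \in [set x | phi x != 0] & v t x != 0].
  move=> Z0; apply: isolated_direct => t x z tZ; rewrite !inE negbK => px /eqP pz tx.
  by apply/eqP/negPn/negP=> tz; case/eqP: px; apply: (pairing_ends two (Z0 t tZ) tz tx).
have notund (Z : {set T}) : (forall t, t \in Z -> pairing v phi t = 0) -> e \in Z ->
    X \subset Z -> ~ undecomposable v Z.
  move=> Z0 eZ XZ und; have [A [B [EZ dAB dir inA Aends]]] := isoW Z Z0.
  have [A0|B0] := und A B EZ dAB dir.
    by have := inA e a eZ; rewrite A0 !inE => /(_ phia ea).
  have [t tX] := nongraphic_neq0.
  have : t \in A by have := subsetP XZ t tX; rewrite -EZ B0 setU0.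
  by case/Aends=> x; rewrite inE => px tx; case/eqP: px; apply: phiX; apply/endsP; exists t.
have XY : X \subset ground M :\: Y.
  by apply/subsetP=> t tX; rewrite in_setD inE (subsetP XM t tX) (phiX0 t tX) eqxx.
have Y0 : Y != set0.
  apply/negP=> /eqP Y0; apply: (notund (ground M)) => // t tM.
  by apply/eqP/negPn/negP=> pt; have : t \in Y; [rewrite inE tM | rewrite Y0 inE].
(* On Y every functional vanishing off Y is a multiple of phi, which makes Y a minimal support. The
   factor is the one for which the difference h vanishes at a. *)
have scale (g : V -> 'F_3) : (forall t, t \in ground M :\: Y -> pairing v g t = 0) ->
    exists mu, forall t, t \in Y -> pairing v g t = mu * pairing v phi t.
  move=> gY; exists (g a / phi a).
  have gX : forall x, x \in ends X -> g x = 0.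
    by apply: vanish => t /(subsetP XY); apply: gY.
  have gO t : t \in outside -> pairing v g t = 0.
    move=> tO; apply: gY; rewrite !inE phiO // eqxx andbF /=.
    by move: tO; rewrite inE => /andP[].
  pose h x := g x - (g a / phi a) * phi x.
  have hO t : t \in outside -> pairing v h t = 0.
    by move=> tO; rewrite pairingB gO // [X in _ * X](phiO t tO) mulr0 subr0.
  have ha : h a = 0 by rewrite /h divfK // subrr.
  have h0 x : phi x != 0 -> h x = 0.
    move=> px; apply/eqP/negPn/negP=> hx.
    (* On an edge off X, h is nonzero at all ends or at none, so replacing phi by 0 wherever h is
       nonzero keeps it in [R], as h vanishes at a. The support would shrink. *)
    have Rr : R [ffun z => if h z == 0 then phi z else 0].
      apply/RP; split=> [z zX|t tO|]; last by rewrite ffunE ha eqxx.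
        by rewrite ffunE phiX // if_same.
      have [[z hz tz]|no] := classic (exists2 z, h z != 0 & v t z != 0).
        rewrite /pairing big1 // => u _; have [->|tu] := eqVneq (v t u) 0; first by rewrite mulr0.
        rewrite ffunE; case: eqP => [hu|_]; last by rewrite mul0r.
        by case/eqP: hz; apply: (pairing_ends two (hO t tO) tu tz).
      rewrite -[RHS](phiO t tO); apply: eq_bigr => u _.
      have [->|tu] := eqVneq (v t u) 0; first by rewrite !mulr0.
      by rewrite ffunE; case: eqP => // hu; case: no; exists u => //; apply/eqP.
    have := minphi _ Rr; rewrite leqNgt => /negP; apply; apply: proper_card.
    apply/properP; split.
      by apply/subsetP=> z; rewrite !inE ffunE; case: ifP => //; rewrite eqxx.
    by exists x; rewrite inE // ffunE (negPf hx) eqxx.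
  move=> t; rewrite inE => /andP[tM pt].
  have tO : t \notin outside by apply: contraNN pt => tO; rewrite phiO.
  have [x xX tx] := not_outside tM tO.
  have [z zx tz] : exists2 z, phi z != 0 & v t z != 0.
    apply: NNPP => no; case/eqP: pt; rewrite /pairing big1 // => u _.
    have [->|tu] := eqVneq (v t u) 0; first by rewrite mulr0.
    by have [->|pu] := eqVneq (phi u) 0; [rewrite mul0r | case: no; exists u].
  have xz : x != z by apply: contraNneq zx => <-; rewrite phiX.
  rewrite !(pairing_two two _ xz tx tz) (gX x xX) (phiX x xX) !mul0r !add0r mulrA.
  by congr (_ * _); apply/eqP; rewrite -subr_eq0 -/(h z) h0.
have cY : cocircuit M Y.
  apply: (cocircuitI (phi := phi) rv) => //; first by apply/subsetP=> t; rewrite inE => /andP[].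
    by move=> t tM; rewrite inE tM.
  move=> g gY [t tM gt] u uY; have [mu gE] := scale g gY.
  have tY : t \in Y by apply: contraNT gt => tY; rewrite gY // inE tY.
  rewrite gE // mulf_neq0 //; last by move: uY; rewrite inE => /andP[].
  by apply: contraNneq gt => mu0; rewrite gE // mu0 mul0r.
(* Both X and e survive the deletion of Y, on different sides of the support of phi. *)
apply: (notund (ground M :\: Y)) => //.
- by move=> t; rewrite !inE => /andP[+ tM]; rewrite tM /= negbK => /eqP.
- by rewrite !inE phiO // eqxx andbF eM.
by apply: hns cY _ => /(graphic_on_sub XY).
Qed.

End NongraphicPart.

(* An edge e of B joins X to a vertex w, and all edges at w go to the ends of X. Those in A or Y'
   would put e in the span of A or meet the flat spanned by A and B, so the star of w in M \ Y is
   a parallel class, which is a separator of M \ Y. *)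
Lemma deletion_contradiction Y Y' X A B :
  (forall Y, cocircuit M Y -> ~ graphic_on M (ground M :\: Y) ->
    undecomposable v (ground M :\: Y)) ->
  undecomposable v (ground M :\: Y) -> cocircuit (delete M Y) Y' ->
  A :|: B = ground M :\: Y :\: Y' -> [disjoint A & B] -> direct v A B -> B != set0 ->
  X \subset A -> undecomposable v X -> ~ graphic_on M X -> False.
Proof.
move=> hns undY cY' EF dAB dir /set0Pn[e eB] sXA X_und X_ng.
have AF : A \subset ground M :\: Y :\: Y' by rewrite -EF subsetUl.
have BF : B \subset ground M :\: Y :\: Y' by rewrite -EF subsetUr.
have FM : ground M :\: Y :\: Y' \subset ground M :\: Y by apply: subsetDl.
have sub_ground t : t \in ground M :\: Y -> t \in ground M by case/setDP.
have XF : X \subset ground M :\: Y by apply: subset_trans sXA (subset_trans AF FM).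
have XM : X \subset ground M by apply: subset_trans XF (subsetDl _ _).
have [t0 t0X] := nongraphic_neq0 X_ng.
have eY : e \in ground M :\: Y by apply: (subsetP FM); apply: (subsetP BF).
have eM := sub_ground e eY.
(* A zero vector would by itself be a direct summand of M. *)
have [x ex] : exists x, v e x != 0.
  apply: NNPP => no; have e0 x : v e x = 0 by apply/eqP/negPn/negP=> ex; apply: no; exists x.
  have [|||E0|E0] := @M_und [set e] (ground M :\ e).
  - by rewrite setD1K.
  - by rewrite disjoints1 !inE eqxx.
  - by move=> c _ _ x; rewrite big_set1 e0 mulr0.
  - by have := set11 e; rewrite E0 inE.
  have : t0 \in ground M :\ e; last by rewrite E0 inE.
  rewrite in_setD1 (subsetP XM) // andbT; apply: contraTneq eB => <-.
  by rewrite (disjointFr dAB (subsetP sXA _ t0X)).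
have spanX := ends_supported_inspan XM X_und X_ng.
have spanA w : inspan v X w -> inspan v A w by apply: inspan_mono.
have not_spanA : ~ inspan v A (v e).
  move=> sA; have := direct_inspan dAB dir sA (inspan_gen v eB).
  by move=> e0; rewrite e0 eqxx in ex.
have [w wX ew] : exists2 w, w \notin ends X & v e w != 0.
  apply: NNPP => no; apply: not_spanA; apply: spanA; apply: spanX => z zX.
  by apply/eqP/negPn/negP=> ez; apply: no; exists z.
(* The multiple of e cancels the entry at w, and the other end of each of the two edges is an end of
   X. *)
have linked t : t \in ground M -> v t w != 0 ->
    inspan v X (fun x => v t x - (v t w / v e w) * v e x).
  move=> tM tw; apply: spanX => z zX; have [->|zw] := eqVneq z w; first by rewrite divfK // subrr.
  have end0 u : u \in ground M -> v u w != 0 -> v u z = 0.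
    move=> uM uw; have uO : u \notin outside X.
      by apply: contraNN uw => uO; rewrite (outside_zero XM X_und X_ng hns uO).
    have [b bX ub] := not_outside uM uO; apply/eqP/negPn/negP=> uz.
    have bw : b != w by apply: contraNneq wX => <-.
    by case: (two ub uw uz bw) => E1; [rewrite E1 bX in zX | rewrite E1 eqxx in zw].
  by rewrite !end0 // mulr0 subrr.
have star t : t \in ground M :\: Y -> v t w != 0 ->
    forall x, v t x = (v t w / v e w) * v e x.
  move=> tY tw; have tM := sub_ground t tY; have lt := linked t tM tw.
  have tY' : t \notin Y'.
    (* If t were in Y', it would still lie in the span of A and B, on which the functional of Y'
       vanishes. *)
    apply/negP=> tY'.
    have [_ _ [psi psiP]] := cocircuit_functional (represents_delete (Y := Y) rv) cY'.
    have psi0 u : u \in A :|: B -> pairing v psi u = 0.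
      rewrite EF => /setDP[uY uY']; apply/eqP/negPn.
      by rewrite psiP.
    have : inspan v (A :|: B) (v t).
      apply: (inspanD (w := fun x => v t x - (v t w / v e w) * v e x) (w' := v e)
        (k := v t w / v e w)).
      - by apply: inspan_mono lt; apply: subset_trans sXA (subsetUl _ _).
      - by apply: inspan_gen; rewrite inE eB orbT.
      by move=> z; rewrite subrK.
    move/inspan_pairing/(_ psi0) => E0.
    by have := psiP t tY; rewrite tY' /pairing E0 eqxx.
  have : t \in A :|: B by rewrite EF !inE tY' -in_setD.
  (* If t is in A, then e lies in the span of A. If t is in B, the difference lies in both spans and
     is therefore 0. *)
  rewrite inE => /orP[tA|tB].
    case: not_spanA.
    have lam0 : v t w / v e w != 0 by rewrite mulf_neq0 ?invr_eq0.
    apply: (inspanZ (w := fun x => (v t w / v e w) * v e x) (k := (v t w / v e w)^-1)).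
      apply: (inspanD (inspan_gen v tA) (spanA _ lt) (k := -1)) => x'.
      by rewrite mulN1r opprB addrC subrK.
    by move=> x'; rewrite mulKf.
  have lB : inspan v B (fun x => v t x - (v t w / v e w) * v e x).
    apply: (inspanD (w := v t) (w' := v e) (k := - (v t w / v e w))).
    - exact: inspan_gen.
    - exact: inspan_gen.
    by move=> z; rewrite mulNr.
  by move=> z; apply/eqP; rewrite -subr_eq0; apply/eqP;
    exact: (direct_inspan dAB dir (spanA _ lt) lB).
pose A1 := [set t in ground M :\: Y | v t w != 0].
have A1Y : A1 \subset ground M :\: Y by apply/subsetP=> t; rewrite inE => /andP[].
have eA1 : e \in A1 by rewrite inE eY.
have [|||E0|E0] := undY A1 (ground M :\: Y :\: A1).
- by rewrite -[RHS](setID _ A1) (setIidPr A1Y).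
- by rewrite disjoints_subset setCD subsetUr.
- move=> c sc z u.
  (* At w only the vectors of [A1] are nonzero. Being multiples of one vector, they form a vanishing
     sum as soon as the entry at w vanishes. *)
  have zw : \sum_(t in A1) c t * v t w = 0.
    rewrite -[RHS](z w) (comb_in _ _ sc) [RHS](bigID (mem A1)) /=.
    rewrite [X in _ = _ + X]big1 ?addr0 => [|t /andP[+ tA1]].
      by apply: eq_bigl => t; rewrite in_setU; case: (t \in A1); rewrite ?andbF.
    rewrite in_setU (negPf tA1) => /setDP[tY _].
    by move: tA1; rewrite inE tY negbK => /eqP ->; rewrite mulr0.
  rewrite (eq_bigr (fun t => c t * v t w * ((v e w)^-1 * v e u))).
    by rewrite -mulr_suml zw mul0r.
  by move=> t; rewrite inE => /andP[tY tw]; rewrite (star t tY tw u) !mulrA.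
- by rewrite E0 inE in eA1.
have : t0 \in ground M :\: Y :\: A1; last by rewrite E0 inE.
rewrite in_setD (subsetP XF) // andbT inE (subsetP XF) //= negbK.
by apply: contraNT wX => tw; apply/endsP; exists t0.
Qed.

End Main.

(** As M \ Y is connected, a summand A of M would lie in Y, and then equal Y because it already
    supports a functional. Hence Y' is a cocircuit of M, and M \ Y' is non-graphic but splits off
    A. *)
Lemma direct_ground_undecomposable (T V : finType) (v : T -> V -> 'F_3) (M : matroid T)
    (Y Y' : {set T}) : represents v M ->
  (forall Y, cocircuit M Y -> ~ graphic_on M (ground M :\: Y) ->
    undecomposable v (ground M :\: Y)) ->
  cocircuit M Y -> undecomposable v (ground M :\: Y) -> cocircuit (delete M Y) Y' ->
  ~ graphic_on M (ground M :\: Y :\: Y') -> undecomposable v (ground M).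
Proof.
move=> rv hns cY undY cY' ngF A B EM dAB dir; apply: NNPP => /not_or_and[/eqP A0 /eqP B0].
have [sY Y0 [phi phiP]] := cocircuit_functional rv cY.
wlog AY : A B EM dAB dir A0 B0 / A \subset Y.
  move=> wl; have [||| |] := undY (A :\: Y) (B :\: Y).
  - by rewrite -setDUl EM.
  - by apply: disjointWl (subsetDl _ _) _; apply: disjointWr (subsetDl _ _) _.
  - exact: (direct_sub dAB (subsetDl _ _) (subsetDl _ _) dir).
  - by move/eqP; rewrite setD_eq0; apply: (wl A B).
  move/eqP; rewrite setD_eq0; apply: (wl B A) => //.
  - by rewrite setUC.
  - by rewrite disjoint_sym.
  exact: direct_sym dir.
have [a aA] := set0Pn _ A0; have aY := subsetP AY a aA; have aM := subsetP sY a aY.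
have BM : B \subset ground M by rewrite -EM subsetUr.
(* A functional vanishing on B but not on a; its support lies in A, so minimality of the cocircuit Y
   forces Y to lie in A. *)
have [theta [thB thA]] : exists theta, (forall t, t \in B -> pairing v theta t = 0) /\
    \sum_x theta x * v a x != 0.
  apply: not_inspan => sB.
  have : pairing v phi a = 0; last by apply/eqP; rewrite phiP.
  apply: big1 => x _.
  by rewrite (direct_inspan dAB dir (inspan_gen v aA) sB) mulr0.
have YA : Y = A.
  apply/eqP; rewrite eqEsubset AY andbT; apply/subsetP=> t tY.
  have : t \in ground M by apply: (subsetP sY).
  rewrite -EM inE => /orP[//|tB].
  suff : pairing v theta t != 0 by rewrite thB // eqxx.
  apply: (cocircuit_minimal rv cY) tY => [u|]; last by exists a.
  move=> /setDP[uM uY]; apply: thB; move: uM; rewrite -EM inE => /orP[uA|//].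
  by rewrite (subsetP AY) in uY.
have EB : ground M :\: Y = B.
  by rewrite -EM YA setDUl setDv set0U; apply/setDidPl; rewrite disjoint_sym.
have rvY := represents_delete (Y := Y) rv.
have [sY' Y'0 [psi psiP]] := cocircuit_functional rvY cY'.
rewrite /= EB in sY' psiP.
have [e eY'] := set0Pn _ Y'0; have eB := subsetP sY' e eY'.
pose F := B :\: Y'.
(* The functional psi of Y' is controlled only on B, while th must vanish on A as well. It exists
   because, by directness, e in the span of A and F would be in the span of F, where psi
   vanishes. *)
have [th [thF the]] : exists th, (forall t, t \in A :|: F -> pairing v th t = 0) /\
    \sum_x th x * v e x != 0.
  apply: not_inspan => -[c [sc ce]].
  have : pairing v psi e = 0; last by apply/eqP; rewrite psiP.
  have sc' : supported (A :|: B) (fun t => c t - 1 * (if t == e then 1 else 0)).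
    move=> t; rewrite inE negb_or => /andP[tA tB].
    rewrite sc ?inE ?negb_or ?tA ?(negPf tB) ?andbF // sub0r.
    by case: eqP => [te|_]; [rewrite te eB in tB | rewrite mulr0 oppr0].
  have zA x : \sum_(t in A) c t * v t x = 0.
    have := dir _ sc' _ x.
    rewrite (eq_bigr (fun t => c t * v t x)) => [|t tA]; last first.
      case: eqP => [te|_]; last by rewrite mulr0 subr0.
      by have := disjointFr dAB tA; rewrite te eB.
    by apply=> u; rewrite combB comb_delta ce !mul1r subrr.
  have dAF : [disjoint A & F] by apply: disjointWr dAB; apply: subsetDl.
  have : inspan v F (v e).
    exists (fun t => if t \in F then c t else 0); split=> [t /negPf -> //|x].
    by rewrite comb_restrict -ce (comb_setU v x dAF sc) zA add0r.
  move/inspan_pairing; apply=> t; rewrite inE => /andP[tY' tB].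
  by apply/eqP/negPn; rewrite psiP.
have cMY' : cocircuit M Y'.
  have restrict g : (forall t, t \in ground M :\: Y' -> pairing v g t = 0) ->
      (exists2 t, t \in ground M & pairing v g t != 0) ->
      forall t, t \in Y' -> pairing v g t != 0.
    move=> g0 [t tM gt]; apply: (cocircuit_minimal rvY cY').
      by move=> u /setDP[/setDP[uM _] uY']; apply: g0; rewrite inE uY'.
    exists t => //; rewrite /= EB; have tY' : t \in Y'.
      by apply: contraNT gt => tY'; rewrite g0 // inE tY'.
    exact: (subsetP sY').
  have th0 t : t \in ground M :\: Y' -> pairing v th t = 0.
    rewrite -EM => /setDP[+ tY']; rewrite inE => tAB; apply: thF.
    by rewrite !inE tY'.
  apply: (cocircuitI (phi := th) rv) => //; first exact: subset_trans BM.
  move=> t tM; have [tY'|tY'] := boolP (t \in Y').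
    apply: restrict => //; exists e => //; exact: (subsetP BM).
  by rewrite th0 ?eqxx // inE tY'.
have sF : F \subset ground M :\: Y' by apply: setSD.
have [|||| A00|F0] := hns Y' cMY' _ A F.
- by move/(graphic_on_sub sF); rewrite /F -EB.
- rewrite -EM setDUl -/F; congr (_ :|: _); apply/esym/setDidPl.
  exact: disjointWr sY' dAB.
- exact: disjointWr (subsetDl _ _) dAB.
- exact: (direct_sub dAB (subxx _) (subsetDl _ _) dir).
- by rewrite A00 eqxx in A0.
by apply: ngF; rewrite EB -/F F0; apply: graphic_on0.
Qed.

Lemma inc_two_support (F : fieldType) (V E : finType) (G : graph V E) (neg : pred E) :
  two_support (inc F G neg).
Proof.
move=> e x y z /inc_incident + /inc_incident + /inc_incident; rewrite /incident.
case: (G e) => [a b|a|] //.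
  by do 3! [case/orP=> /eqP ->]; rewrite ?eqxx; auto.
by move=> /eqP -> /eqP ->; rewrite eqxx.
Qed.

Lemma graphic_on_deleteI (T : finType) (M : matroid T) (X Y : {set T}) :
  X \subset ground M :\: Y -> graphic_on M X -> graphic_on (delete M Y) X.
Proof.
move=> sX [V [G [GX h]]]; exists V, G; split=> // X' sX'.
by rewrite -h // inE (subset_trans sX' sX) andbT.
Qed.

Theorem theorem3p14 (V E : finType) (S : signed_graph V E) (M : matroid E)
    (hM : is_signed_graphic_matroid S M)
    (hbin : binary M)
    (hns : forall Y : {set E}, nongraphic_cocircuit M Y -> nonseparating M Y)
    (Y : {set E}) (hY : nongraphic_cocircuit M Y) :
  forall Y' : {set E},
    nongraphic_cocircuit (delete M Y) Y' -> nonseparating (delete M Y) Y'.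
Proof.
move=> Y' [cY' ngY']; apply/negP=> sep.
pose v := inc 'F_3 (sgraph S) (negative_edge S).
have rv : represents v M by apply: signed_graphic_represents.
have two : two_support v by apply: inc_two_support.
have [n [f rf]] := binary_represented hbin.
have und Z : cocircuit M Z -> ~ graphic_on M (ground M :\: Z) -> undecomposable v (ground M :\: Z).
  move=> cZ ngZ; apply: (connected_undecomposable (represents_delete (Y := Z) rv)).
  by apply: hns; split=> // /graphic_deleteP.
have [cY ngY] := hY.
have undY : undecomposable v (ground M :\: Y) by apply: und cY _ => /graphic_deleteP.
have ngF : ~ graphic_on M (ground M :\: Y :\: Y').
  by move=> /(graphic_on_deleteI (subsetDl _ _))/graphic_deleteP.
have undM := direct_ground_undecomposable rv und cY undY cY' ngF.
have rF := represents_delete (Y := Y') (represents_delete (Y := Y) rv).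
have [A [B [EF dAB dir [A0 B0]]]] := disconnected_direct rF sep.
have [X [sX X_ng minX]] := minimal_nongraphic ngF.
have X_und : undecomposable v X.
  apply: (minimal_nongraphic_undecomposable rv _ X_ng minX).
  exact: subset_trans sX (subset_trans (subsetDl _ _) (subsetDl _ _)).
have EX : (X :&: A) :|: (X :&: B) = X by rewrite -setIUr EF; apply/setIidPl.
have dX : [disjoint X :&: A & X :&: B].
  by apply: disjointWl (subsetIr _ _) _; apply: disjointWr (subsetIr _ _) _.
have [XA|XB] := X_und _ _ EX dX (direct_sub dAB (subsetIr _ _) (subsetIr _ _) dir).
  have sXB : X \subset B by rewrite -EX XA set0U subsetIr.
  apply: (deletion_contradiction two rv rf undM und undY cY' _ _ (direct_sym dAB dir) A0 sXB) => //.
  - by rewrite setUC.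
  - by rewrite disjoint_sym.
have sXA : X \subset A by rewrite -EX XB setU0 subsetIr.
exact: (deletion_contradiction two rv rf undM und undY cY' EF dAB dir B0 sXA).
Qed.
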